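(* Let $(A,\phi_0)$ be a Jacobi algebroid of rank $n$ over $M$, with $A$ and $M$ orientable, let $P$ be a Jacobi bivector on $(A,\phi_0)$, and let $X_0=-P^\sharp(\phi_0)$. Equip $A^*$ with the Lie algebroid structure over $M$ induced by $P$ and $\hat A^*=A^*\times\mathbb R$ with the Lie algebroid structure over $M\times\mathbb R$ induced by the Poisson bivector $\tilde P=e^{-t}P$ on $\hat A$. Let $\nu\in\Gamma(\wedge^nA^* )$ be a non-vanishing section, let $\mu$ be a volume form on $M$, and put $\hat\nu=e^{nt}\nu$ and $\tilde\mu=\mu\wedge dt$. Then: (1) the modular form of the Lie algebroid $A^*$ with respect to $\nu\otimes\mu$ satisfies $$\xi_{A^*}^{\nu\otimes\mu}(\alpha)=e^t\,\xi_{\hat A^*}^{\hat\nu\otimes\tilde\mu}(\alpha)\qquad\text{for all }\alpha\in\Gamma(A^* );$$ (2) the modular form of the Jacobi algebroid $(A^*,X_0)$ with respect to $\nu\otimes\mu$ is given by $$\xi_{A^*}^{X_0,\,\nu\otimes\mu}=e^t\,\xi_{\hat A^*}^{\nu\otimes\tilde\mu}+X_0 .$$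
   Context: A Jacobi algebroid $(A,\phi_0)$ is a Lie algebroid $(A,[\cdot,\cdot],\rho)$ over $M$ with a 1-cocycle $\phi_0\in\Gamma(A^* )$ ($\mathrm d\phi_0=0$). The Schouten bracket on $\Gamma(\wedge^\bullet A)$ extends the Lie bracket with $[X,f]=\rho(X)f$, $[P,Q]=-(-1)^{(p-1)(q-1)}[Q,P]$, $[P,Q\wedge R]=[P,Q]\wedge R+(-1)^{(p-1)q}Q\wedge[P,R]$; the same conventions are used for every Lie algebroid. The Schouten-Jacobi bracket is $[P,Q]^{\phi_0}=[P,Q]+(p-1)P\wedge i_{\phi_0}Q-(-1)^{p-1}(q-1)\,i_{\phi_0}P\wedge Q$. For a bivector $P$, $\langle\beta,P^\sharp\alpha\rangle=P(\alpha,\beta)$. A Jacobi bivector is $P\in\Gamma(\wedge^2A)$ with $[P,P]^{\phi_0}=0$. The Lie algebroid $\hat A=A\times\mathbb R\to M\times\mathbb R$ induced from $A$ by $\phi_0$ is determined on time-independent sections $X,Y\in\Gamma(A)$ by $[X,Y]_{\hat A}=[X,Y]$, $\hat\rho(X)=\rho(X)+\langle\phi_0,X\rangle\frac{\partial}{\partial t}$. Then $\tilde P=e^{-t}P$ is a Poisson bivector on $\hat A$ ($[\tilde P,\tilde P]_{\hat A}=0$), and $\hat A^*$ is a Lie algebroid with bracket $[\alpha,\beta]_{\tilde P}=\widehat{\mathcal L}_{\tilde P^\sharp\alpha}\beta-\widehat{\mathcal L}_{\tilde P^\sharp\beta}\alpha-\hat{\mathrm d}(\tilde P(\alpha,\beta))$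 and anchor $\hat\rho\circ\tilde P^\sharp$, where $\widehat{\mathcal L},\hat{\mathrm d}$ are the Lie derivative and differential of $\hat A$. With $\mathrm d^{\phi_0}\omega=\mathrm d\omega+\phi_0\wedge\omega$ and $\mathcal L_X^{\phi_0}=i_X\mathrm d^{\phi_0}+\mathrm d^{\phi_0}i_X$, the Lie algebroid structure on $A^*$ induced by $P$ has bracket $[\alpha,\beta]_P=\mathcal L^{\phi_0}_{P^\sharp\alpha}\beta-\mathcal L^{\phi_0}_{P^\sharp\beta}\alpha-\mathrm d^{\phi_0}(P(\alpha,\beta))$ and anchor $\rho\circ P^\sharp$; $X_0$ is a 1-cocycle of $A^*$. For a Lie algebroid $(B,[\cdot,\cdot],\rho_B)$ over $S$ with non-vanishing $\eta\in\Gamma(\wedge^{\mathrm{top}}B)$, $\mu\in\Omega^{\mathrm{top}}(S)$, the modular form $\xi_B^{\eta\otimes\mu}\in\Gamma(B^* )$ is defined by $\langle\xi_B^{\eta\otimes\mu},X\rangle\,\eta\otimes\mu=[X,\eta]\otimes\mu+\eta\otimes\mathcal L_{\rho_B(X)}\mu$ for $X\in\Gamma(B)$. For a Jacobi algebroid $(B,\phi)$ of rank $n$, the modular form with respect to $\eta\otimes\mu$ is $\xi_B^{\phi,\eta\otimes\mu}=\xi_B^{\eta\otimes\mu}-(n-1)\phi$. Sections of $A$ and $A^*$ are regarded as time-independent sections of $\hat A$ and $\hat A^*$. *)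

(* Defs.v *)
From HB Require Import structures.
From Stdlib Require List.
From mathcomp Require Import all_boot all_order all_algebra.
From mathcomp Require Import all_classical all_reals all_analysis.

Set Implicit Arguments.
Unset Strict Implicit.
Unset Printing Implicit Defensive.
Import Order.TTheory GRing.Theory Num.Theory numFieldNormedType.Exports.
Local Open Scope classical_set_scope.
Local Open Scope ring_scope.

Section CkFunctions.
Variable R : realType.

(* Meant for open U: all iterated partial derivatives of order <= k exist and
   are continuous on U. *)
Fixpoint Ck (m k : nat) (U : set 'rV[R]_m) (f : 'rV[R]_m -> R) : Prop :=
  (forall x, U x -> {for x, continuous f}) /\
  (if k is k'.+1 then
     forall j : 'I_m,
       (forall x, U x -> derivable f x (delta_mx 0 j)) /\
       Ck k' U (fun x => 'D_(delta_mx 0 j) f x)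
   else True).

Lemma Ck_sub m k (U V : set 'rV[R]_m) f : V `<=` U -> Ck k U f -> Ck k V f.
Proof.
move=> VU; elim: k f => [|k IH] f /= [cf df]; split.
- by move=> x /VU; exact: cf.
- by [].
- by move=> x /VU; exact: cf.
- move=> j; have [d1 d2] := df j; split; first by move=> x /VU; exact: d1.
  exact: IH.
Qed.

Lemma derive_flat m (f : 'rV[R]_m -> R) x v :
  (forall h : R, f (h *: v + x) = f x) -> derivable f x v /\ 'D_v f x = 0.
Proof.
move=> H.
have E : (fun h : R => h^-1 *: ((f \o shift x) (h *: v) - f x)) = fun=> 0.
  by apply/funext => h /=; rewrite H subrr scaler0.
rewrite /derivable /derive E; split; first exact: is_cvg_cst.
exact: lim_cst.
Qed.

Lemma Ck_cst m k (U : set 'rV[R]_m) (c : R) : Ck k U (fun=> c).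
Proof.
elim: k c => [|k IH] c /=; split => //.
- by move=> x _; exact: cst_continuous.
- by move=> x _; exact: cst_continuous.
- move=> j; split; first by move=> x _; have [] := @derive_flat m (fun=> c) x (delta_mx 0 j).
  have -> : (fun x : 'rV[R]_m => 'D_(delta_mx 0 j) (fun=> c) x) = fun=> 0.
    by apply/funext => x; have [] := @derive_flat m (fun=> c) x (delta_mx 0 j).
  exact: IH.
Qed.

Lemma Ck_coord m k (U : set 'rV[R]_m) (l : 'I_m) : Ck k U (fun y => y 0 l).
Proof.
have cc (x : 'rV[R]_m) : {for x, continuous (fun y : 'rV[R]_m => y 0 l)}.
  exact: coord_continuous.
case: k => [|k] /=; split => // j.
have E (x : 'rV[R]_m) :
    h^-1 *: (((fun y : 'rV[R]_m => y 0 l) \o shift x) (h *: (delta_mx 0 j : 'rV[R]_m)) - x 0 l)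
    @[h --> (0:R)^'] --> ((l == j)%:R : R).
  apply: (@cvg_trans _ (((l == j)%:R : R) @[_ --> (0:R)^'])); last exact: cvg_cst.
  apply: near_eq_cvg; near=> h.
  have h0 : h != 0 by near: h; exact: nbhs_dnbhs_neq.
  rewrite /= !mxE eqxx /= addrK.
  by rewrite -[RHS]/(h^-1 * (h * (l == j)%:R)) mulrA mulVf // mul1r.
split; first by move=> x _; apply/cvg_ex; exists ((l == j)%:R : R); exact: E.
have -> : (fun x : 'rV[R]_m => 'D_(delta_mx 0 j) (fun y : 'rV[R]_m => y 0 l) x)
   = fun=> ((l == j)%:R : R).
  by apply/funext => x; apply: cvg_lim => //; exact: E.
exact: Ck_cst.
Unshelve. all: by end_near. Qed.

Lemma row_cvg (T : Type) (F : set_system T) (FF : Filter F) m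
    (f : T -> 'rV[R]_m) (a : 'rV[R]_m) :
  (forall l, f y 0 l @[y --> F] --> a 0 l) -> f y @[y --> F] --> a.
Proof.
move=> H A [P Pa sPA]; rewrite /= /fmap /=.
have HP l : \forall y \near F, P 0 l (f y 0 l) by apply: H; exact: Pa.
apply: (@filterS _ F FF _ _ _ (filter_forall FF HP)) => y Py.
by apply: sPA => i j; rewrite (ord1 i); exact: Py.
Qed.

Lemma lsubmx_cts m p : continuous (fun y : 'rV[R]_(m + p) => lsubmx y).
Proof.
move=> y; apply: (row_cvg (nbhs_filter y)) => l; rewrite mxE.
have -> : (fun y : 'rV[R]_(m + p) => lsubmx y 0 l) = fun y => y 0 (lshift p l).
  by apply/funext => z; rewrite mxE.
exact: coord_continuous.
Qed.

Lemma Ck_lsubmx m p k (U : set 'rV[R]_m) f :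
  Ck k U f -> Ck k [set y : 'rV[R]_(m + p) | U (lsubmx y)] (fun y => f (lsubmx y)).
Proof.
have lin (h : R) (u y : 'rV[R]_(m + p)) :
    lsubmx (h *: u + y) = h *: lsubmx u + lsubmx y.
  by apply/rowP => i; rewrite !mxE.
have eL (j : 'I_m) : lsubmx (delta_mx 0 (lshift p j) : 'rV[R]_(m + p)) = delta_mx 0 j.
  by apply/rowP => i; rewrite [LHS]mxE [LHS]mxE [RHS]mxE (inj_eq (@lshift_inj _ _)).
have eR (j : 'I_p) : lsubmx (delta_mx 0 (rshift m j) : 'rV[R]_(m + p)) = 0.
  by apply/rowP => i; rewrite [LHS]mxE [LHS]mxE [RHS]mxE eq_lrshift andbF.
have comp (g : 'rV[R]_m -> R) : (forall x, U x -> {for x, continuous g}) ->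
    forall y : 'rV[R]_(m + p), U (lsubmx y) -> {for y, continuous (fun y => g (lsubmx y))}.
  move=> cg y Uy.
  exact: (@continuous_comp _ _ _ (fun y : 'rV[R]_(m + p) => lsubmx y) g y
    (@lsubmx_cts m p y) (cg _ Uy)).
elim: k f => [|k IH] f /= [cf df]; split; [exact: comp|by []|exact: comp|].
move=> j; case: (split_ordP j) => i ->.
- have E y : (fun h : R => h^-1 *: (((fun y : 'rV[R]_(m + p) => f (lsubmx y)) \o shift y)
        (h *: delta_mx 0 (lshift p i)) - f (lsubmx y)))
      = (fun h : R => h^-1 *: ((f \o shift (lsubmx y)) (h *: delta_mx 0 i) - f (lsubmx y))).
    by apply/funext => h /=; rewrite lin eL.
  have [d1 d2] := df i; split.
    by move=> y /d1; rewrite /derivable E.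
  have -> : (fun y : 'rV[R]_(m + p) => 'D_(delta_mx 0 (lshift p i)) (fun y => f (lsubmx y)) y)
     = (fun y => 'D_(delta_mx 0 i) f (lsubmx y)).
    by apply/funext => y; rewrite /derive E.
  exact: (IH _ d2).
- have H y (h : R) : f (lsubmx (h *: delta_mx 0 (rshift m i) + y : 'rV[R]_(m + p))) = f (lsubmx y).
    by rewrite lin eR scaler0 add0r.
  have F y := @derive_flat (m + p) (fun z => f (lsubmx z)) y (delta_mx 0 (rshift m i)) (H y).
  split; first by move=> y _; have [] := F y.
  have -> : (fun y : 'rV[R]_(m + p) => 'D_(delta_mx 0 (rshift m i)) (fun y => f (lsubmx y)) y)
     = fun=> 0.
    by apply/funext => y; have [] := F y.
  exact: Ck_cst.
Qed.

End CkFunctions.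

Lemma hausdorff_prod (T U : topologicalType) :
  hausdorff_space T -> hausdorff_space U -> hausdorff_space (T * U)%type.
Proof.
move=> hT hU [a b] [c d] H; congr pair.
- apply: hT => A B nA nB.
  have [] := H (A `*` setT) (B `*` setT).
  + by exists (A, setT) => //; split => //; exact: filterT.
  + by exists (B, setT) => //; split => //; exact: filterT.
  by move=> [x y] [[/= ? _] [/= ? _]]; exists x.
- apply: hU => A B nA nB.
  have [] := H (setT `*` A) (setT `*` B).
  + by exists (setT, A) => //; split => //; exact: filterT.
  + by exists (setT, B) => //; split => //; exact: filterT.
  by move=> [x y] [[/= _ ?] [/= _ ?]]; exists y.
Qed.

Lemma second_countable_prod (T U : topologicalType) :
  @second_countable T -> @second_countable U -> @second_countable (T * U)%type.
Proof.
move=> [B cB [oB bB]] [C cC [oC bC]].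
exists [set W | exists2 V, (B `*` C) V & W = V.1 `*` V.2].
  apply: (@sub_countable _ _ _ ((fun V : set T * set U => V.1 `*` V.2) @` (B `*` C))).
    apply: subset_card_le => W [V BV ->]; by exists V.
  apply: (card_le_trans (card_image_le _ _)); exact: countableX.
split=> [W [[V1 V2] [/= /oB ? /oC ?] ->]|[x y] W [[P Q] /= [nP nQ] sW]].
  rewrite openE => -[u v] [/= Vu Vv]; exists (V1, V2) => //.
  by split; exact: open_nbhs_nbhs.
have [P' [bP' P'x] sP] := bB _ _ nP; have [Q' [bQ' Q'y] sQ] := bC _ _ nQ.
exists (P' `*` Q') => /=; first by split => //; exists (P', Q').
by move=> [u v] [/= /sP ? /sQ ?]; exact: sW.
Qed.

Lemma second_countable_R (R : realType) : @second_countable R.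
Proof.
exists [set B | exists2 q : rat * rat, setT q & B = ball (ratr q.1 : R) (ratr q.2)].
  apply: (@sub_countable _ _ _ ((fun q : rat * rat => ball (ratr q.1 : R) (ratr q.2)) @` setT)).
    apply: subset_card_le => W [V BV ->]; by exists V.
  apply: (card_le_trans (card_image_le _ _)); exact: countableP.
split=> [W [q _ ->]|x W]; first exact: ball_open.
rewrite nbhsE => -[V [oV Vx] sV].
have [c [r [xB sB]]] := open_subball_rat oV (mem_set Vx).
exists (ball (ratr c : R) (ratr r)) => /=.
  by split; [exists (c, r)|exact: set_mem].
exact: subset_trans sV.
Qed.

Section Manifolds.
Variable R : realType.

Record manifold := Manifold {
  mspace :> topologicalType;
  mdim : nat;
  matlas : Type;
  mdom : matlas -> set mspace;
  mchart : matlas -> mspace -> 'rV[R]_mdim;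
  mchartV : matlas -> 'rV[R]_mdim -> mspace;
  mhausdorff : hausdorff_space mspace;
  msecond_countable : @second_countable mspace;
  mdom_cover : forall x, exists i, mdom i x;
  mdom_open : forall i, open (mdom i);
  mchart_open : forall i, open (mchart i @` mdom i);
  mchartK : forall i x, mdom i x -> mchartV i (mchart i x) = x;
  mchart_continuous : forall i x, mdom i x -> {for x, continuous (mchart i)};
  mchartV_continuous : forall i y, (mchart i @` mdom i) y ->
    {for y, continuous (mchartV i)};
  mtransition : forall i j l k, Ck k (mchart i @` (mdom i `&` mdom j))
    (fun y => mchart j (mchartV i y) 0 l) }.

Definition smooth_on (S : manifold) (U : set S) (f : S -> R) : Prop :=
  forall i k, Ck k (mchart i @` (U `&` mdom i)) (fun y => f (mchartV i y)).

Record cinf (S : manifold) := Cinf {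
  cfun :> S -> R;
  cinf_smooth : smooth_on setT cfun }.

Section Cylinder.
Variable M : manifold.

Definition cyl_dom (i : matlas M) := [set p : M * R | mdom i p.1].
Definition cyl_chart (i : matlas M) (p : M * R) : 'rV[R]_(mdim M + 1) :=
  row_mx (mchart i p.1) (const_mx p.2).
Definition cyl_chartV (i : matlas M) (y : 'rV[R]_(mdim M + 1)) : M * R :=
  (mchartV i (lsubmx y), rsubmx y 0 0).

Lemma cyl_chart_image i (V : set M) :
  cyl_chart i @` [set p | V p.1] = [set y | (mchart i @` V) (lsubmx y)].
Proof.
apply/seteqP; split => [_ [p Vp <-]|y [x Vx xy]] /=.
  by rewrite row_mxKl; exists p.1.
exists (x, rsubmx y 0 0) => //; rewrite /cyl_chart /= xy -[RHS]hsubmxK.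
by congr row_mx; apply/rowP => k; rewrite (ord1 k) [LHS]mxE.
Qed.

Lemma cyl_transition i j l k : Ck k (cyl_chart i @` (cyl_dom i `&` cyl_dom j))
  (fun y => cyl_chart j (cyl_chartV i y) 0 l).
Proof.
rewrite (cyl_chart_image i (mdom i `&` mdom j)).
case: (split_ordP l) => a ->.
- have -> : (fun y => cyl_chart j (cyl_chartV i y) 0 (lshift 1 a)) =
            (fun y => mchart j (mchartV i (lsubmx y)) 0 a).
    by apply/funext => y; rewrite /cyl_chart row_mxEl.
  exact: (Ck_lsubmx 1 (f := fun z => mchart j (mchartV i z) 0 a) (@mtransition M i j a k)).
- have -> : (fun y => cyl_chart j (cyl_chartV i y) 0 (rshift (mdim M) a)) =
            (fun y => y 0 (rshift (mdim M) a)).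
    by apply/funext => y; rewrite /cyl_chart row_mxEr [LHS]mxE /= mxE (ord1 a).
  exact: Ck_coord.
Qed.

Lemma cyl_cover p : exists i, cyl_dom i p.
Proof. by have [i ?] := mdom_cover p.1; exists i. Qed.

Lemma cyl_open i : open (cyl_dom i).
Proof.
by apply: open_comp => [p _|]; [exact: cvg_fst|exact: mdom_open].
Qed.

Lemma cyl_chart_open i : open (cyl_chart i @` cyl_dom i).
Proof.
rewrite cyl_chart_image; apply: open_comp => [y _|]; first exact: lsubmx_cts.
exact: mchart_open.
Qed.

Lemma cyl_chartK i p : cyl_dom i p -> cyl_chartV i (cyl_chart i p) = p.
Proof.
case: p => x t /= ix; rewrite /cyl_chartV /cyl_chart row_mxKl row_mxKr /= mxE.
by rewrite mchartK.
Qed.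

Lemma cyl_chart_continuous i p : cyl_dom i p -> {for p, continuous (cyl_chart i)}.
Proof.
move=> ip; apply: (row_cvg (nbhs_filter p)) => l.
case: (split_ordP l) => a ->.
- have -> : (fun q => cyl_chart i q 0 (lshift 1 a)) = (fun z : 'rV[R]_(mdim M) => z 0 a) \o mchart i \o fst.
    by apply/funext => q; rewrite /cyl_chart row_mxEl.
  rewrite /cyl_chart row_mxEl.
  have c1 : {for p.1, continuous ((fun z : 'rV[R]_(mdim M) => z 0 a) \o mchart i)}.
    exact: (@continuous_comp _ _ _ (mchart i) (fun z : 'rV[R]_(mdim M) => z 0 a)
      p.1 (@mchart_continuous M i p.1 ip) (@coord_continuous R _ _ 0 a (mchart i p.1))).
  apply: (@continuous_comp _ _ _ fst ((fun z : 'rV[R]_(mdim M) => z 0 a) \o mchart i) p _ c1).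
  exact: cvg_fst.
- have -> : (fun q => cyl_chart i q 0 (rshift (mdim M) a)) = snd.
    by apply/funext => q; rewrite /cyl_chart row_mxEr mxE.
  by rewrite /cyl_chart row_mxEr mxE; exact: cvg_snd.
Qed.

Lemma cyl_chartV_continuous i y : (cyl_chart i @` cyl_dom i) y ->
  {for y, continuous (cyl_chartV i)}.
Proof.
rewrite (cyl_chart_image i (mdom i)) => iy.
have c1 : {for y, continuous (fun z : 'rV[R]_(mdim M + 1) => mchartV i (lsubmx z))}.
  exact: (@continuous_comp _ _ _ (fun z : 'rV[R]_(mdim M + 1) => lsubmx z)
    (mchartV i) y (@lsubmx_cts R _ _ y) (@mchartV_continuous M i _ iy)).
have c2 : {for y, continuous (fun z : 'rV[R]_(mdim M + 1) => rsubmx z 0 0)}.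
  have -> : (fun z : 'rV[R]_(mdim M + 1) => rsubmx z 0 0) =
            (fun z => z 0 (rshift (mdim M) 0)).
    by apply/funext => z; rewrite mxE.
  exact: (@coord_continuous R _ _ 0 (rshift (mdim M) 0) y).
exact: (@cvg_pair _ _ _ (nbhs y) _ _ (nbhs_filter y) _ _ _ _ c1 c2).
Qed.

Definition cylinder : manifold :=
  @Manifold (M * R)%type (mdim M + 1) (matlas M) cyl_dom cyl_chart cyl_chartV
    (hausdorff_prod (@mhausdorff M) (@Rhausdorff R))
    (second_countable_prod (@msecond_countable M) (second_countable_R R))
    cyl_cover cyl_open cyl_chart_open cyl_chartK cyl_chart_continuous
    cyl_chartV_continuous cyl_transition.

Lemma smooth_on_fst (U : set M) f : smooth_on U f ->
  smooth_on (S := cylinder) [set p | U p.1] (fun p => f p.1).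
Proof.
move=> sf i k; change (Ck k (cyl_chart (i : matlas M) @` [set p : M * R | (U `&` @mdom M i) p.1])
  (fun y => f (cyl_chartV i y).1)); rewrite cyl_chart_image.
exact: (Ck_lsubmx 1 (f := fun z => f (@mchartV M i z)) (sf i k)).
Qed.

Lemma smooth_on_snd U : smooth_on (S := cylinder) U snd.
Proof.
move=> i k; have -> : (fun y => (mchartV (m := cylinder) i y).2) =
    (fun y => y 0 (rshift (mdim M) 0)).
  by apply/funext => z; rewrite /= mxE.
exact: Ck_coord.
Qed.

Definition cinf_fst (f : cinf M) : cinf cylinder :=
  @Cinf cylinder (fun p => f p.1) (smooth_on_fst (@cinf_smooth M f)).

Definition cinf_snd : cinf cylinder := @Cinf cylinder snd (@smooth_on_snd setT).

End Cylinder.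
End Manifolds.

Section Bundles.
Variable R : realType.

Section DualTrivialization.
Variables (n : nat) (E : vectType R).

Definition dual_coords (tV : 'Hom('rV[R]_n, E)) (a : 'Hom(E, R^o)) : 'rV[R]_n :=
  \row_k a (tV (delta_mx 0 k)).

Lemma dual_coords_linear tV : linear (dual_coords tV).
Proof. by move=> c a b; apply/rowP => k; rewrite !mxE add_lfunE scale_lfunE. Qed.

HB.instance Definition _ tV := GRing.isLinear.Build R 'Hom(E, R^o) 'rV[R]_n _
  (dual_coords tV) (dual_coords_linear tV).

Definition covector_fun (t : 'Hom(E, 'rV[R]_n)) (v : 'rV[R]_n) (e : E) : R^o :=
  \sum_k v 0 k * t e 0 k.

Lemma covector_fun_linear t v : linear (covector_fun t v).
Proof.
move=> c a b; rewrite /covector_fun scaler_sumr -big_split /=; apply: eq_bigr => k _.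
by rewrite linearP !mxE mulrDr mulrCA.
Qed.

HB.instance Definition _ t v := GRing.isLinear.Build R E R^o _
  (covector_fun t v) (covector_fun_linear t v).

Definition covector (t : 'Hom(E, 'rV[R]_n)) (v : 'rV[R]_n) : 'Hom(E, R^o) :=
  linfun (covector_fun t v).

Lemma covectorE t v e : covector t v e = \sum_k v 0 k * t e 0 k.
Proof. by rewrite lfunE. Qed.

Lemma covector_linear t : linear (covector t).
Proof.
move=> c a b; apply/lfunP => e; rewrite add_lfunE scale_lfunE !covectorE.
rewrite scaler_sumr -big_split /=; apply: eq_bigr => k _.
by rewrite !mxE mulrDl -mulrA.
Qed.

HB.instance Definition _ t := GRing.isLinear.Build R 'rV[R]_n 'Hom(E, R^o) _
  (covector t) (covector_linear t).

Definition ev_fun (e : E) (a : 'Hom(E, R^o)) : R^o := a e.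

Lemma ev_fun_linear e : linear (ev_fun e).
Proof. by move=> c a b; rewrite /ev_fun add_lfunE scale_lfunE. Qed.

HB.instance Definition _ e := GRing.isLinear.Build R 'Hom(E, R^o) R^o _
  (ev_fun e) (ev_fun_linear e).

Definition ev (e : E) : 'Hom('Hom(E, R^o), R^o) := linfun (ev_fun e).

Lemma evE e a : ev e a = a e. Proof. by rewrite lfunE. Qed.

End DualTrivialization.

(* A smooth vector bundle of rank n, given by its fibres and a cover by local
   trivializations with smooth transition matrices; triv i x and trivV i x are
   meaningful for x in tdom i only. *)
Record vbundle (S : manifold R) (n : nat) := VBundle {
  fib : S -> vectType R;
  tidx : Type;
  tdom : tidx -> set S;
  triv : forall (i : tidx) x, 'Hom(fib x, 'rV[R]_n);
  trivV : forall (i : tidx) x, 'Hom('rV[R]_n, fib x);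
  tdom_open : forall i, open (tdom i);
  tdom_cover : forall x, exists i, tdom i x;
  trivK : forall i x, tdom i x -> cancel (triv i x) (trivV i x);
  trivVK : forall i x, tdom i x -> cancel (trivV i x) (triv i x);
  ttransition : forall i j k l, smooth_on (tdom i `&` tdom j)
    (fun x => triv j x (trivV i x (delta_mx 0 k)) 0 l) }.

Definition sections (S : manifold R) n (B : vbundle S n) := forall x, fib B x.

Definition smooth_section (S : manifold R) n (B : vbundle S n) (X : sections B) :=
  forall i k, smooth_on (tdom i) (fun x => triv i x (X x) 0 k).

Section Dual.
Variables (S : manifold R) (n : nat) (B : vbundle S n).

Definition dual_fib x : vectType R := 'Hom(fib B x, R^o).

Definition dual_triv (i : tidx B) x : 'Hom(dual_fib x, 'rV[R]_n) :=
  linfun (dual_coords (trivV i x)).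

Definition dual_trivV (i : tidx B) x : 'Hom('rV[R]_n, dual_fib x) :=
  linfun (covector (triv i x)).

Lemma dual_trivK i x : tdom i x -> cancel (dual_triv i x) (dual_trivV i x).
Proof.
move=> ix a; rewrite !lfunE; apply/lfunP => e; rewrite covectorE.
rewrite -[in RHS](trivK ix e) [in RHS](row_sum_delta (triv i x e)) !linear_sum /=.
by apply: eq_bigr => k _; rewrite mxE 2!linearZ /= [LHS]mulrC.
Qed.

Lemma dual_trivVK i x : tdom i x -> cancel (dual_trivV i x) (dual_triv i x).
Proof.
move=> ix v; rewrite !lfunE; apply/rowP => k; rewrite mxE covectorE.
rewrite (bigD1 k) //= trivVK // mxE !eqxx mulr1 big1 ?addr0 // => l lk.
by rewrite mxE (negPf lk) andbF mulr0.
Qed.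

Lemma dual_transition i j k l : smooth_on (tdom i `&` tdom j)
  (fun x => dual_triv j x (dual_trivV i x (delta_mx 0 k)) 0 l).
Proof.
have -> : (fun x => dual_triv j x (dual_trivV i x (delta_mx 0 k)) 0 l) =
          (fun x => triv i x (trivV j x (delta_mx 0 l)) 0 k).
  apply/funext => x; rewrite !lfunE mxE covectorE (bigD1 k) //=.
  rewrite mxE !eqxx mul1r big1 ?addr0 // => a ak.
  by rewrite mxE (negPf ak) andbF mul0r.
by rewrite setIC; exact: ttransition.
Qed.

Definition dual : vbundle S n :=
  @VBundle S n dual_fib (tidx B) (@tdom _ _ B) dual_triv dual_trivV
    (@tdom_open _ _ B) (@tdom_cover _ _ B) dual_trivK dual_trivVK dual_transition.

End Dual.

Section PullBack.
Variables (M : manifold R) (n : nat) (A : vbundle M n).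

Definition pull_dom (i : tidx A) : set (cylinder M) := [set p | tdom i p.1].

Lemma pull_open i : open (pull_dom i).
Proof.
by apply: open_comp => [p _|]; [exact: cvg_fst|exact: tdom_open].
Qed.

Lemma pull_cover (p : cylinder M) : exists i, pull_dom i p.
Proof. exact: tdom_cover. Qed.

Definition pull : vbundle (cylinder M) n :=
  @VBundle (cylinder M) n (fun p => fib A p.1) (tidx A) pull_dom
    (fun i p => triv i p.1) (fun i p => trivV i p.1)
    pull_open pull_cover
    (fun i p => @trivK _ _ A i p.1) (fun i p => @trivVK _ _ A i p.1)
    (fun i j k l => smooth_on_fst (@ttransition _ _ A i j k l)).

Definition pull_section (X : sections A) : sections pull := fun p => X p.1.

End PullBack.
End Bundles.

Section ExteriorAlgebra.
Variables (R : realType) (V : Type).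

(* number of inversions of the shuffle that moves the selected entries to the
   front *)
Fixpoint shuffle_inv (m : bitseq) : nat :=
  if m is b :: m' then ((if b then 0 else count id m') + shuffle_inv m')%N else 0%N.

(* Determinant convention: (a /\ b)(u, v) = a(u) b(v) - a(v) b(u). *)
Definition wedge (p q : seq V -> R) (s : seq V) : R :=
  \sum_(m : (size s).-tuple bool)
    (-1) ^+ shuffle_inv m * p (mask m s) * q (mask (map negb m) s).

Definition contract (v : V) (p : seq V -> R) (s : seq V) : R := p (v :: s).

End ExteriorAlgebra.

Section TangentVectors.
Variables (R : realType) (S : manifold R).

(* df/dx^j in the chart i *)
Definition pderiv (i : matlas S) (j : 'I_(mdim S)) (f : S -> R) (x : S) : R :=
  'D_(delta_mx 0 j) (fun y => f (mchartV i y)) (mchart i x).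

(* Tangent vectors at x are the functionals on smooth functions of the form
   sum_j a_j d/dx^j in the charts around x. *)
Definition tangent (x : S) (v : cinf S -> R) : Prop :=
  forall i, mdom i x -> exists a : 'I_(mdim S) -> R,
    forall f, v f = \sum_j a j * pderiv i j f x.

(* First-order operators with smooth coefficients in every chart; only their
   values on smooth functions are meaningful. *)
Definition vector_field (Z : (S -> R) -> S -> R) : Prop :=
  forall i, exists2 a : 'I_(mdim S) -> S -> R,
    (forall j, smooth_on (mdom i) (a j)) &
    forall x, mdom i x -> forall f : cinf S, Z f x = \sum_j a j x * pderiv i j f x.

Definition tangent_at (x : S) (Z : (S -> R) -> S -> R) : cinf S -> R :=
  fun f => Z f x.

Definition vf_bracket (Z Y : (S -> R) -> S -> R) : (S -> R) -> S -> R :=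
  fun f x => Z (Y f) x - Y (Z f) x.

Definition forms := forall x : S, seq (cinf S -> R) -> R.

Definition form_eval (w : forms) (Ys : seq ((S -> R) -> S -> R)) (x : S) : R :=
  w x (map (tangent_at x) Ys).

Definition kform (k : nat) (w : forms) : Prop :=
  [/\ forall x s, size s <> k -> w x s = 0,
      forall x s1 s2 u v (a : R), List.Forall (tangent x) (s1 ++ [:: u, v & s2]) ->
        w x (s1 ++ (fun f => a * u f + v f) :: s2) =
        a * w x (s1 ++ u :: s2) + w x (s1 ++ v :: s2),
      forall x s1 s2 s3 u, List.Forall (tangent x) (s1 ++ u :: s2 ++ u :: s3) ->
        w x (s1 ++ u :: s2 ++ u :: s3) = 0 &
      forall Ys, List.Forall vector_field Ys -> smooth_on setT (form_eval w Ys)].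

(* At each point, being non-zero is tested on values of vector fields, which
   exhaust the tangent vectors. *)
Definition volume_form (w : forms) : Prop :=
  kform (mdim S) w /\
  forall x, exists2 Ys, List.Forall vector_field Ys & form_eval w Ys x <> 0.

(* (L_Z w)(Y_1, ..., Y_k) *)
Definition form_lie (Z : (S -> R) -> S -> R) (w : forms)
    (Ys : seq ((S -> R) -> S -> R)) (x : S) : R :=
  Z (form_eval w Ys) x -
  \sum_(i < size Ys)
    form_eval w (take i Ys ++ vf_bracket Z (nth (fun=> fun=> 0) Ys i) :: drop i.+1 Ys) x.

End TangentVectors.

(* the form mu /\ dt on M x R *)
Definition wedge_dt (R : realType) (M : manifold R) (mu : forms M) :
    forms (cylinder M) :=
  fun p => wedge
    (fun s => mu p.1 (map (fun (v : cinf (cylinder M) -> R) f => v (cinf_fst f)) s))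
    (fun s => if s is [:: v] then v (cinf_snd M) else 0).

Section LieAlgebroids.
Variables (R : realType) (S : manifold R) (n : nat).

(* lbr and lanc are only meaningful on smooth sections and functions.
   Linearity of the bracket over R follows from lbrC, lbrD and lbr_leibniz. *)
Record lie_algebroid (B : vbundle S n) := LieAlgebroid {
  lbr : sections B -> sections B -> sections B;
  lanc : sections B -> (S -> R) -> S -> R;
  lbr_smooth : forall X Y, smooth_section X -> smooth_section Y ->
    smooth_section (lbr X Y);
  lanc_vector_field : forall X, smooth_section X -> vector_field (lanc X);
  lancD : forall X Y (f : cinf S) x, smooth_section X -> smooth_section Y ->
    lanc (fun y => X y + Y y) f x = lanc X f x + lanc Y f x;
  lancZ : forall X (g f : cinf S) x, smooth_section X ->
    lanc (fun y => g y *: X y) f x = g x * lanc X f x;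
  lbrC : forall X Y x, smooth_section X -> smooth_section Y ->
    lbr X Y x = - lbr Y X x;
  lbrD : forall X Y Z x,
    smooth_section X -> smooth_section Y -> smooth_section Z ->
    lbr X (fun y => Y y + Z y) x = lbr X Y x + lbr X Z x;
  lbr_leibniz : forall X Y (f : cinf S) x, smooth_section X -> smooth_section Y ->
    lbr X (fun y => f y *: Y y) x = f x *: lbr X Y x + lanc X f x *: Y x;
  lbr_jacobi : forall X Y Z x,
    smooth_section X -> smooth_section Y -> smooth_section Z ->
    lbr X (lbr Y Z) x + lbr Y (lbr Z X) x + lbr Z (lbr X Y) x = 0 }.

Section Differential.
Variables (B : vbundle S n) (L : lie_algebroid B) (phi : sections (dual B)).

Definition pairing (a : sections (dual B)) (X : sections B) (x : S) : R := a x (X x).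

(* d f and d a for a function f and a 1-form a *)
Definition d0 (f : S -> R) (X : sections B) (x : S) : R := lanc L X f x.

Definition d1 (a : sections (dual B)) (X Y : sections B) (x : S) : R :=
  lanc L X (pairing a Y) x - lanc L Y (pairing a X) x - pairing a (lbr L X Y) x.

(* d^phi = d + phi /\ - *)
Definition d0_tw (f : S -> R) (X : sections B) (x : S) : R :=
  d0 f X x + f x * pairing phi X x.

Definition d1_tw (a : sections (dual B)) (X Y : sections B) (x : S) : R :=
  d1 a X Y x + (pairing phi X x * pairing a Y x - pairing phi Y x * pairing a X x).

(* L^phi_X = i_X d^phi + d^phi i_X on 1-forms *)
Definition lie_tw (X : sections B) (a : sections (dual B)) (Y : sections B) (x : S) : R :=
  d1_tw a X Y x + d0_tw (pairing a X) Y x.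

Definition jacobi_algebroid : Prop :=
  smooth_section phi /\
  forall X Y x, smooth_section X -> smooth_section Y -> d1 phi X Y x = 0.

End Differential.

Section Multivectors.
Variable B : vbundle S n.

Definition mvec := forall x, seq (fib (dual B) x) -> R.

Definition mvec_fun (f : S -> R) : mvec := fun x s => if s is [::] then f x else 0.

Definition mvec_sec (X : sections B) : mvec :=
  fun x s => if s is [:: a] then (a : 'Hom(fib B x, R^o)) (X x) else 0.

Definition mwedge (P Q : mvec) : mvec := fun x => wedge (P x) (Q x).

(* Elements of degree p of the exterior algebra of the module of sections, which
   is the space of sections of the p-th exterior power of B. *)
Definition multivector (p : nat) (P : mvec) : Prop :=
  exists (N : nat) (f : 'I_N -> cinf S) (X : 'I_N -> 'I_p -> sections B),
    (forall k j, smooth_section (X k j)) /\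
    forall x s, P x s = \sum_k
      f k x * (\big[mwedge/mvec_fun (fun=> 1)]_(j < p) mvec_sec (X k j)) x s.

Definition nonvanishing (P : mvec) : Prop := forall x, exists s, P x s <> 0.

Definition icontract (a : sections (dual B)) (P : mvec) : mvec :=
  fun x => contract (a x) (P x).

(* <b, P^# a> = P(a, b) *)
Definition sharp (P : mvec) (a : sections (dual B)) : sections B :=
  fun x => xget 0 [set v : fib B x |
    forall b : 'Hom(fib B x, R^o), b v = P x [:: a x; b]].

(* The Schouten bracket of L, meaningful on multivectors, where it is unique. The sign exponents
   use p + 1 in place of p - 1. *)
Record schouten (L : lie_algebroid B) := Schouten {
  sbr : mvec -> mvec -> mvec;
  sbr_deg : forall p q r P Q, multivector p P -> multivector q Q ->
    (p + q = r.+1)%N -> multivector r (sbr P Q);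
  sbr_fun_fun : forall P Q, multivector 0 P -> multivector 0 Q ->
    forall x (s : seq (fib (dual B) x)), sbr P Q s = 0;
  sbrD : forall p q P Q Q', multivector p P -> multivector q Q -> multivector q Q' ->
    forall x (s : seq (fib (dual B) x)), sbr P (fun y t => Q y t + Q' y t) s = sbr P Q s + sbr P Q' s;
  sbr_sec_fun : forall X (f : cinf S), smooth_section X ->
    forall x (s : seq (fib (dual B) x)), sbr (mvec_sec X) (mvec_fun f) s = mvec_fun (lanc L X f) s;
  sbr_sec_sec : forall X Y, smooth_section X -> smooth_section Y ->
    forall x (s : seq (fib (dual B) x)), sbr (mvec_sec X) (mvec_sec Y) s = mvec_sec (lbr L X Y) s;
  sbrC : forall p q P Q, multivector p P -> multivector q Q ->
    forall x (s : seq (fib (dual B) x)), sbr P Q s = - (-1) ^+ (p.+1 * q.+1) * sbr Q P s;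
  sbr_leibniz : forall p q r P Q T,
    multivector p P -> multivector q Q -> multivector r T ->
    forall x (s : seq (fib (dual B) x)), sbr P (mwedge Q T) s =
      mwedge (sbr P Q) T s + (-1) ^+ (p.+1 * q) * mwedge Q (sbr P T) s }.

(* the Schouten-Jacobi bracket of P of degree p and Q of degree q *)
Definition schouten_jacobi (L : lie_algebroid B) (SB : schouten L)
    (phi : sections (dual B)) (p q : nat) (P Q : mvec) : mvec :=
  fun x s => sbr SB P Q s
    + (p%:R - 1) * mwedge P (icontract phi Q) s
    - (-1) ^+ p.+1 * (q%:R - 1) * mwedge (icontract phi P) Q s.

Definition jacobi_bivector (L : lie_algebroid B) (SB : schouten L)
    (phi : sections (dual B)) (P : mvec) : Prop :=
  multivector 2 P /\
  forall x (s : seq (fib (dual B) x)), schouten_jacobi SB phi 2 2 P P s = 0.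

(* Ld is the Lie algebroid structure on the dual bundle induced by the bivector
   P; phi = 0 gives the structure induced by a Poisson bivector. *)
Definition induced_dual (L : lie_algebroid B) (phi : sections (dual B)) (P : mvec)
    (Ld : lie_algebroid (dual B)) : Prop :=
  (forall a b X x, smooth_section a -> smooth_section b -> smooth_section X ->
     pairing (lbr Ld a b) X x =
       lie_tw L phi (sharp P a) b X x - lie_tw L phi (sharp P b) a X x
       - d0_tw L phi (fun y => P y [:: a y; b y]) X x) /\
  (forall a (f : cinf S) x, smooth_section a ->
     lanc Ld a f x = lanc L (sharp P a) f x).

(* The equation
     <xi, X> eta (x) mu = [X, eta] (x) mu + eta (x) L_{rho(X)} mu,
   evaluated on covectors s and vector fields Ys. *)
Definition modular_form (L : lie_algebroid B) (SB : schouten L) (eta : mvec)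
    (mu : forms S) (xi : sections (dual B)) : Prop :=
  smooth_section xi /\
  forall X, smooth_section X ->
  forall x (s : seq (fib (dual B) x)) Ys, List.Forall (@vector_field R S) Ys ->
    pairing xi X x * (eta x s * form_eval mu Ys x) =
    sbr SB (mvec_sec X) eta s * form_eval mu Ys x +
    eta x s * form_lie (lanc L X) mu Ys x.

Definition jacobi_modular_form (L : lie_algebroid B) (SB : schouten L)
    (phi : sections (dual B)) (eta : mvec) (mu : forms S)
    (xi : sections (dual B)) : Prop :=
  exists2 xi0, modular_form SB eta mu xi0 &
    forall x, xi x = xi0 x - (n%:R - 1) *: phi x.

End Multivectors.
End LieAlgebroids.

(* Lh is the Lie algebroid structure on A x R -> M x R induced by phi, which is
   determined by its values on time-independent sections. *)
Definition induced_hat (R : realType) (M : manifold R) (n : nat) (A : vbundle M n)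
    (L : lie_algebroid A) (phi : sections (dual A))
    (Lh : lie_algebroid (pull A)) : Prop :=
  (forall X Y p, smooth_section X -> smooth_section Y ->
     lbr Lh (pull_section X) (pull_section Y) p = lbr L X Y p.1) /\
  (forall X (F : cinf (cylinder M)) x t, smooth_section X ->
     lanc Lh (pull_section X) F (x, t) =
       lanc L X (fun y => F (y, t)) x + pairing phi X x * derive1 (fun r : R => F (x, r)) t).

(* Main.v *)
Require Import Defs.
From mathcomp Require Import all_boot all_order all_algebra.
From mathcomp Require Import all_classical all_reals all_analysis.
From mathcomp Require Import ring lra.
Import Order.TTheory GRing.Theory Num.Theory numFieldNormedType.Exports.
Local Open Scope ring_scope.

(** The map [alpha |-> e^t alpha] from sections of [A^*] to sections of
    [(A x R)^*] preserves brackets, because the terms that [phi0] contributes to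
    the twisted operators of [A] are exactly the time derivatives of the factor
    [e^t]. The anchor of [e^t alpha] is [rho(P^# alpha) + g d/dt] with
    [g = phi0(P^# alpha)], which is time-independent, so that its Lie derivative
    of [mu /\ dt] is [(L_{rho(P^# alpha)} mu) /\ dt]. Writing
    [e^{ct} nu] as [e^{(c-n)t}] times wedges of [n] sections of the form
    [e^t beta], one gets
      [ [e^t alpha, e^{ct} nu] = e^{ct} ([alpha, nu] + (c - n) g nu) ],
    and hence [e^t xihat(alpha) = xi(alpha) + (c - n) g]. The two claims are the
    cases [c = n] and [c = 0], since [g = alpha(X0)]. *)

Set Implicit Arguments.
Unset Strict Implicit.
Unset Printing Implicit Defensive.
Local Open Scope classical_set_scope.

(** * Smooth functions and sections *)

Section Calculus.
Variable R : realType.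
Implicit Types f g : R -> R.

(** Restricting [g] to the line [h |-> h *: v + x] reduces this to the chain rule in one variable,
    so only differentiability of [g] along [v] is involved. *)
Lemma derive_comp1 (V : normedModType R) f (g : V -> R) x v :
  derivable g x v -> derivable f (g x) 1 ->
  derivable (f \o g) x v /\ 'D_v (f \o g) x = derive1 f (g x) * 'D_v g x.
Proof.
move=> dg df; pose G h := g (h *: v + x).
have lineD (u : V -> R) : 'D_v u x = derive1 (fun h : R => u (h *: v + x)) 0.
  rewrite derive1E /derive; set q1 := fun h => _; set q2 := fun h => _.
  suff -> : q1 = q2 by [].
  by apply/funext => h; rewrite /q1 /q2 /= addr0 scale0r add0r [_%:A]mulr1.
have G0 : G 0 = g x by rewrite /G scale0r add0r.
have dG : derivable G 0 1 by have /derivable1P := dg.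
have dfG : derivable f (G 0) 1 by rewrite G0.
split.
  apply/derivable1P; apply/derivable1_diffP.
  move/derivable1_diffP: dG; move/derivable1_diffP: dfG => h1 h2.
  exact: (differentiable_comp h2 h1).
rewrite !lineD -[X in _ = _ * X]/(derive1 G 0) -G0.
exact: (derive1_comp dG dfG).
Qed.

(** * The flat function [exp (-1/u)] and the exponentials *)

Section Flat.
Implicit Type p : {poly R}.

(* These functions form a family stable under derivation (flat_derive), so that
   smoothness of [exp (-1/u)] at 0 reduces to continuity of the whole family. *)
Definition flat p (u : R) : R := if 0 < u then p.[u^-1] * expR (- u^-1) else 0.

(** For [u > 0] the exponential series gives [u^-(i+1) / (i+1)! <= exp (1/u)], hence
    [u^-i * exp (-1/u) <= (i+1)! * u]; summing over the monomials of [p] gives the constant. *)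
Lemma flat_bound p : exists C, forall u, `|flat p u| <= C * `|u|.
Proof.
exists (\sum_(i < size p) `|p`_i| * (i.+1)`!%:R) => u; rewrite /flat.
case: ifPn => [u0|_]; last first.
  by rewrite normr0 mulr_ge0 // sumr_ge0 // => i _; rewrite mulr_ge0.
rewrite (gtr0_norm u0) horner_coef !mulr_suml.
apply: (le_trans (ler_norm_sum _ _ _)); apply: ler_sum => i _.
have y0 : 0 < u^-1 by rewrite invr_gt0.
rewrite !normrM (gtr0_norm (expR_gt0 _)) normrX (gtr0_norm y0) -!mulrA.
apply: ler_wpM2l => //; rewrite expRN ler_pdivrMr ?expR_gt0 //.
have := expR_ge1Dxn i (ltW y0); set e := expR _; set y := u^-1 in y0 * => He.
have F0 : (0 : R) < i.+1`!%:R by rewrite ltr0n fact_gt0.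
have : y ^+ i.+1 / i.+1`!%:R <= e by apply: le_trans He; rewrite lerDr.
rewrite ler_pdivrMr // exprS => H.
have -> : u = y^-1 by rewrite invrK.
by rewrite mulrAC ler_pdivlMr // mulrC (le_trans H) // mulrC.
Qed.

Lemma flat_cvg0 p : flat p h @[h --> (0 : R)] --> (0 : R).
Proof.
have [C HC] := flat_bound p.
apply/cvgr0Pnorm_le => e e0.
have C1 : 0 < `|C| + 1 by apply: ltr_wpDl.
have : \forall h \near (0 : R), `|h| <= e / (`|C| + 1).
  have d0 : 0 < e / (`|C| + 1) by rewrite divr_gt0.
  by exists (e / (`|C| + 1)) => // y; rewrite /= sub0r normrN => /ltW.
apply: filterS => h; rewrite ler_pdivlMr // => H.
apply: (le_trans (HC h)); apply: le_trans H; rewrite mulrC ler_wpM2l //.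
by rewrite (le_trans (ler_norm _)) // lerDl.
Unshelve. all: by end_near. Qed.

(** Away from 0 this is the chain rule for [p(1/u) exp (-1/u)], whose derivative is
    [u^-2 (p - p')(1/u) exp (-1/u)]. At 0 the difference quotient belongs to the family again. *)
Lemma flat_derive p u :
  is_derive u (1 : R) (flat p) (flat ('X^2 * (p - p^`())) u).
Proof.
have [u0|u0|->] := ltrgt0P u.
- have E : \forall y \near u, p.[y^-1] * expR (- y^-1) = flat p y.
    near=> y; rewrite /flat ifT //; near: y.
    by exists u => //= y; rewrite /= ltr_distlC => /andP[+ _]; rewrite subrr.
  apply: (near_eq_is_derive E).
  have un : u != 0 by rewrite gt_eqF.
  have dV : is_derive u (1 : R) (fun y : R => y^-1) (- u ^- 2).
    by rewrite -[X in is_derive _ _ _ X]mulr1; apply: is_deriveV.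
  have d1 := @is_derive1_comp _ (horner p) _ u _ _ (is_derive_poly p u^-1) dV.
  have d2 := @is_derive1_comp _ expR _ u _ _ (is_derive_expR (- u^-1)) (is_deriveN dV).
  have d3 := is_deriveM d1 d2.
  change (is_derive u (1 : R) ((horner p \o GRing.inv) * (expR \o - GRing.inv))
    (flat ('X^2 * (p - p^`())) u)).
  apply: (is_derive_eq d3).
  by rewrite /flat u0 !hornerE /= /GRing.scale /=; field.
- have E : \forall y \near u, cst 0 y = flat p y.
    near=> y; rewrite /flat ifF //; apply/negbTE; rewrite -leNgt; near: y.
    exists (- u); rewrite /= ?oppr_gt0 // => y.
    by rewrite /= ltr_distlC subrr opprK => /andP[_ /ltW].
  apply: (near_eq_is_derive E); rewrite /flat ifF; first exact: is_derive_cst.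
  by apply/negbTE; rewrite -leNgt ltW.
have F0 q : flat q 0 = 0 by rewrite /flat ltxx.
(* Dividing by [h] multiplies the polynomial in [1/h] by ['X], so the derivative at 0 is the limit
   of [flat ('X * p)], which is 0. *)
have Q : (fun h : R => h^-1 *: ((flat p \o shift 0) (h *: (1 : R)) - flat p 0))
    = flat ('X * p).
  apply/funext => h /=; rewrite F0 subr0 addr0 [_%:A]mulr1 /flat.
  by case: ifP => _; rewrite ?scaler0 // /GRing.scale /= hornerM hornerX; ring.
have L : flat ('X * p) h @[h --> (0 : R)^'] --> (0 : R).
  exact: cvg_within_filter (flat_cvg0 _).
apply: DeriveDef; first by rewrite /derivable Q; apply/cvg_ex; exists 0.
by rewrite /derive Q F0; exact: cvg_lim.
Unshelve. all: by end_near. Qed.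

Definition exp_family f := exists a c, f = (fun u => a * expR (c * u)).

Definition flat_family f := exists p, f = flat p.

(** A derivation-closed family stands in for smoothness of an outer function: [Ck_comp] can pass
    from [f] to its derivative without leaving the family. *)
Definition derive_stable (S : set (R -> R)) := forall f, S f ->
  (forall u, derivable f u 1) /\ S (derive1 f).

Lemma flat_stable : derive_stable flat_family.
Proof.
move=> _ [p ->]; split; first by move=> u; have [] := flat_derive p u.
exists ('X^2 * (p - p^`())); apply/funext => u; rewrite derive1E.
by have [_] := flat_derive p u.
Qed.

Lemma exp_derive_lin a c u :
  is_derive u (1 : R) (fun u => a * expR (c * u)) (a * c * expR (c * u)).
Proof.
have d : is_derive u (1 : R) (fun u => expR (c * u)) (expR (c * u) * c).
  apply: (@is_derive1_comp _ expR (fun u => c * u)).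
  have := @is_deriveZ _ _ _ id c u 1 1 (is_derive_id u 1).
  by rewrite [c *: 1]mulr1.
have := is_deriveZ a d; rewrite -[X in is_derive _ _ _ X]/(a * _) => H.
by apply: is_derive_eq; ring.
Qed.

Lemma exp_stable : derive_stable exp_family.
Proof.
move=> _ [a [c ->]]; split; first by move=> u; have [] := exp_derive_lin a c u.
exists (a * c), c; apply/funext => u; rewrite derive1E.
by have [_] := exp_derive_lin a c u.
Qed.

End Flat.

(** * Closure properties of [Ck] functions on open sets *)

Section Ck.
Variable m : nat.
Implicit Types (U : set 'rV[R]_m) (F G : 'rV[R]_m -> R).

Lemma CkS k U F : Ck k.+1 U F -> Ck k U F.
Proof.
elim: k F => [|k IH] F [cF dF]; first by split.
split=> // j; have [d1 d2] := dF j; split => //; exact: IH.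
Qed.

(** Since [U] is open, agreement on [U] is agreement near each of its points, so the partial
    derivatives agree on [U] as well. *)
Lemma Ck_eq k U F G : open U -> (forall x, U x -> F x = G x) -> Ck k U F -> Ck k U G.
Proof.
move=> oU; elim: k F G => [|k IH] F G FG [cF dF].
  split=> // x Ux; have nFG : \forall y \near x, F y = G y.
    by apply: filterS (open_nbhs_nbhs (conj oU Ux)); exact: FG.
  change (G y @[y --> x] --> G x); rewrite -(FG _ Ux).
  exact: cvg_trans (near_eq_cvg nFG) (cF _ Ux).
have nFG x : U x -> \forall y \near x, F y = G y.
  by move=> Ux; apply: filterS (open_nbhs_nbhs (conj oU Ux)); exact: FG.
split=> [x Ux|j].
  change (G y @[y --> x] --> G x); rewrite -(FG _ Ux).
  exact: cvg_trans (near_eq_cvg (nFG _ Ux)) (cF _ Ux).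
have [d1 d2] := dF j; split.
  by move=> x Ux; apply: near_eq_derivable (d1 _ Ux); exact: nFG.
apply: IH d2 => x Ux; exact: near_eq_derive (nFG _ Ux).
Qed.

Lemma Ck_bigcup (I : Type) (U : I -> set 'rV[R]_m) k F :
  (forall i, Ck k (U i) F) -> Ck k (\bigcup_i U i) F.
Proof.
elim: k F => [|k IH] F H.
  by split=> // x [i _ Ux]; have [c _] := H i; exact: c.
split=> [x [i _ Ux]|j]; first by have [c _] := H i; exact: c.
split=> [x [i _ Ux]|]; first by have [_ /(_ j)[d _]] := H i; exact: d.
by apply: IH => i; have [_ /(_ j)[_]] := H i.
Qed.

Lemma CkD k U F G : open U -> Ck k U F -> Ck k U G -> Ck k U (fun x => F x + G x).
Proof.
move=> oU; elim: k F G => [|k IH] F G [cF dF] [cG dG].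
  by split=> // x Ux; apply: continuousD; [exact: cF|exact: cG].
split=> [x Ux|j]; first by apply: continuousD; [exact: cF|exact: cG].
have [dF1 dF2] := dF j; have [dG1 dG2] := dG j; split.
  by move=> x Ux; apply: derivableD; [exact: dF1|exact: dG1].
apply: (Ck_eq oU _ (IH _ _ dF2 dG2)) => x Ux.
by rewrite -[RHS]/('D_(delta_mx 0 j) (F + G) x) deriveD //; [exact: dF1|exact: dG1].
Qed.

Lemma CkM k U F G : open U -> Ck k U F -> Ck k U G -> Ck k U (fun x => F x * G x).
Proof.
move=> oU; elim: k F G => [|k IH] F G HF HG.
  have [[cF _] [cG _]] := (HF, HG).
  by split=> // x Ux; apply: continuousM; [exact: cF|exact: cG].
(* The product rule pairs a derivative of order [k] with an undifferentiated factor, which has to be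
   lowered to order [k] first. *)
have [HF' HG'] := (CkS HF, CkS HG).
have [[cF dF] [cG dG]] := (HF, HG).
split=> [x Ux|j]; first by apply: continuousM; [exact: cF|exact: cG].
have [dF1 dF2] := dF j; have [dG1 dG2] := dG j; split.
  by move=> x Ux; apply: derivableM; [exact: dF1|exact: dG1].
apply: (Ck_eq oU _ (CkD oU (IH _ _ HF' dG2) (IH _ _ HG' dF2))) => x Ux.
by rewrite -[RHS]/('D_(delta_mx 0 j) (F * G) x) deriveM //; [exact: dF1|exact: dG1].
Qed.

Lemma Ck_sum (I : Type) (r : seq I) (Q : pred I) k U (F : I -> 'rV[R]_m -> R) : open U ->
  (forall i, Q i -> Ck k U (F i)) -> Ck k U (fun x => \sum_(i <- r | Q i) F i x).
Proof.
move=> oU H; elim: r => [|i r IH].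
  by under eq_fun do rewrite big_nil; exact: Ck_cst.
under eq_fun do rewrite big_cons.
case: (boolP (Q i)) => // Qi.
by apply: CkD => //; exact: H.
Qed.

(** Each partial derivative is [(f' o F)] times a partial derivative of [F]; the induction on [k]
    ranges over the whole family so that it covers [f']. *)
Lemma Ck_comp (S : set (R -> R)) k U f F : derive_stable S -> S f -> open U ->
  Ck k U F -> Ck k U (f \o F).
Proof.
move=> HS Sf oU; elim: k f Sf F => [|k IH] f Sf F HF.
  split=> // x Ux; apply: continuous_comp; first by have [c _] := HF; exact: c.
  exact/differentiable_continuous/derivable1_diffP/(HS _ Sf).1.
have [cF dF] := HF; have [df Sf'] := HS _ Sf.
split=> [x Ux|j].
  apply: continuous_comp; first exact: cF.
  exact/differentiable_continuous/derivable1_diffP/df.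
have [d1 d2] := dF j; split.
  by move=> x Ux; have [] := derive_comp1 (d1 _ Ux) (df _).
apply: (Ck_eq oU _ (CkM oU (IH _ Sf' _ (CkS HF)) d2)) => x Ux.
by have [_ ->] := derive_comp1 (d1 _ Ux) (df (F x)).
Qed.

End Ck.
End Calculus.

(** * Smooth functions, vector fields and forms on a manifold *)

Section SmoothFunctions.
Variables (R : realType) (S : manifold R).
Implicit Types (U : set S) (f g : S -> R).

Lemma chart_image_open (i : matlas S) U : open U -> open (mchart i @` (U `&` mdom i)).
Proof.
move=> oU; rewrite openE => _ [x [Ux ix] <-]; rewrite /interior.
have Wx : (mchart i @` mdom i) (mchart i x) by exists x.
have n1 := open_nbhs_nbhs (conj (@mchart_open _ S i) Wx).
have n2 : nbhs (mchart i x) (mchartV i @^-1` U).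
  have /(_ U) := mchartV_continuous Wx; apply.
  by rewrite mchartK //; exact: open_nbhs_nbhs.
apply: filterS (filterI n1 n2) => y [[z iz <-]]; rewrite /= mchartK // => Uz.
by exists z.
Qed.

Lemma smooth_on_sub U V f : V `<=` U -> smooth_on U f -> smooth_on V f.
Proof. by move=> VU sf i k; apply: Ck_sub (sf i k); apply: image_subset; apply: setSI. Qed.

Lemma smooth_on_eq U f g : open U -> (forall x, U x -> f x = g x) ->
  smooth_on U f -> smooth_on U g.
Proof.
move=> oU fg sf i k; apply: Ck_eq (sf i k); first exact: chart_image_open.
by move=> _ [x [Ux ix] <-]; rewrite mchartK //; exact: fg.
Qed.

Lemma smooth_on_bigcup (I : Type) (U : I -> set S) f :
  (forall i, smooth_on (U i) f) -> smooth_on (\bigcup_i U i) f.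
Proof.
move=> sf i k; apply: (@Ck_sub _ _ _ (\bigcup_a (mchart i @` (U a `&` mdom i)))).
  by move=> _ [x [[a _ Ux] ix] <-]; exists a => //; exists x.
by apply: Ck_bigcup => a; exact: sf.
Qed.

Lemma smooth_on_cover (I : Type) (U : I -> set S) f :
  (forall x, exists i, U i x) -> (forall i, smooth_on (U i) f) -> smooth_on setT f.
Proof.
move=> cU /smooth_on_bigcup; apply: smooth_on_sub => x _.
by have [i Ux] := cU x; exists i.
Qed.

Lemma smooth_on_cst U c : smooth_on U (fun=> c).
Proof. by move=> i k; exact: Ck_cst. Qed.

Lemma smooth_onD U f g : open U -> smooth_on U f -> smooth_on U g ->
  smooth_on U (fun x => f x + g x).
Proof. by move=> oU sf sg i k; apply: CkD => //; exact: chart_image_open. Qed.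

Lemma smooth_onM U f g : open U -> smooth_on U f -> smooth_on U g ->
  smooth_on U (fun x => f x * g x).
Proof. by move=> oU sf sg i k; apply: CkM => //; exact: chart_image_open. Qed.

Lemma smooth_on_sum (I : Type) (r : seq I) (Q : pred I) U (f : I -> S -> R) : open U ->
  (forall i, Q i -> smooth_on U (f i)) -> smooth_on U (fun x => \sum_(i <- r | Q i) f i x).
Proof.
move=> oU sf i k; apply: Ck_sum; first exact: chart_image_open.
by move=> a /sf; exact.
Qed.

Lemma smooth_on_comp (F : set (R -> R)) U (h : R -> R) f :
  derive_stable F -> F h -> open U -> smooth_on U f -> smooth_on U (h \o f).
Proof.
move=> HF Fh oU sf i k; apply: (Ck_comp HF Fh _ (sf i k)); exact: chart_image_open.
Qed.

Lemma smooth_on_chart (i : matlas S) l : smooth_on (mdom i) (fun x => mchart i x 0 l).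
Proof. by move=> j k; rewrite setIC; exact: mtransition. Qed.

Lemma vector_field_smooth (Z : (S -> R) -> S -> R) (f : cinf S) :
  vector_field Z -> smooth_on setT (Z f).
Proof.
move=> vZ i k; have [a sa Za] := vZ i.
have oU := @chart_image_open i _ (@openT S).
have sD j : Ck k (mchart i @` (setT `&` mdom i))
    (fun y => 'D_(delta_mx 0 j) (fun y => f (mchartV i y)) y).
  by have [_ /(_ j) []] := @cinf_smooth _ _ f i k.+1.
have sA j : Ck k (mchart i @` (setT `&` mdom i)) (fun y => a j (mchartV i y)).
  by have := sa j i k; rewrite setIid setTI.
have := Ck_sum (index_enum 'I_(mdim S)) (Q := xpredT) oU (fun j _ => CkM oU (sA j) (sD j)).
by apply: Ck_eq => // _ [x [_ ix] <-]; rewrite mchartK // Za.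
Qed.

Lemma vector_field_cst (Z : (S -> R) -> S -> R) c x : vector_field Z -> Z (fun=> c) x = 0.
Proof.
move=> vZ; have [i ix] := mdom_cover x; have [a _ Za] := vZ i.
rewrite (Za _ ix (Cinf (@smooth_on_cst setT c))) big1 // => j _.
by rewrite /pderiv /= (_ : (fun _ => _) = cst c) // derive_cst mulr0.
Qed.

Lemma vector_fieldZ (Z : (S -> R) -> S -> R) c (f : cinf S) x :
  vector_field Z -> Z (fun y => c * f y) x = c * Z f x.
Proof.
move=> vZ; have [i ix] := mdom_cover x; have [a _ Za] := vZ i.
have sf := smooth_onM openT (@smooth_on_cst setT c) (@cinf_smooth _ _ f).
rewrite (Za _ ix (Cinf sf)) Za // mulr_sumr; apply: eq_bigr => j _.
rewrite /pderiv /= mulrCA; congr (_ * _).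
apply: (@deriveZ _ _ _ (fun y => f (mchartV i y)) c).
by have [_ /(_ j) [d _]] := @cinf_smooth _ _ f i 1; apply: d; exists x.
Qed.

Lemma vector_field_tangent (Z : (S -> R) -> S -> R) x :
  vector_field Z -> tangent x (tangent_at x Z).
Proof. by move=> vZ i ix; have [a _ Za] := vZ i; exists (a^~ x) => f; exact: Za. Qed.

Lemma tangent0 (x : S) : tangent x (fun _ : cinf S => 0 : R).
Proof. by move=> i _; exists (fun=> 0) => f; rewrite big1 // => j _; rewrite mul0r. Qed.

(** Linearity applied to [0 = 1 * 0 + 0] makes the value equal to twice itself. *)
Lemma kform0 k (w : forms S) x s1 s2 : kform k w ->
  List.Forall (tangent x) s1 -> List.Forall (tangent x) s2 ->
  w x (s1 ++ (fun=> 0) :: s2) = 0.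
Proof.
move=> [_ wD _ _] t1 t2.
have t : List.Forall (tangent x) (s1 ++ [:: (fun=> 0), (fun=> 0) & s2]).
  apply/List.Forall_app; split=> //.
  by do 2 (apply: List.Forall_cons; first exact: tangent0).
have := wD x s1 s2 _ _ 1 t.
rewrite (_ : (fun f : cinf S => 1 * 0 + 0) = fun=> 0); last first.
  by apply/funext => f; rewrite mulr0 addr0.
by move=> /eqP; rewrite mul1r addrC -subr_eq subrr => /eqP/esym.
Qed.

End SmoothFunctions.

(** * Smooth sections and their pairings *)

Section SmoothSections.
Variables (R : realType) (S : manifold R) (n : nat) (B : vbundle S n).
Implicit Types X Y : sections B.

Lemma smooth_sectionZ f X : smooth_on setT f -> smooth_section X ->
  smooth_section (fun x => f x *: X x).
Proof.
move=> sf sX i k; have oU := @tdom_open _ _ _ B i.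
apply: (smooth_on_eq oU _ (smooth_onM oU (smooth_on_sub (@subsetT _ _) sf) (sX i k))).
by move=> x _; rewrite linearZ mxE.
Qed.

Lemma smooth_section_sum N (X : 'I_N -> sections B) :
  (forall k, smooth_section (X k)) -> smooth_section (fun x => \sum_k X k x).
Proof.
move=> sX i k; have oU := @tdom_open _ _ _ B i.
apply: (smooth_on_eq oU _ (smooth_on_sum (index_enum 'I_N) (Q := xpredT) oU
  (fun a _ => sX a i k))) => x _.
by rewrite linear_sum summxE.
Qed.

Lemma smooth_sectionB X Y : smooth_section X -> smooth_section Y ->
  smooth_section (fun x => X x - Y x).
Proof.
move=> sX sY i k; have oU := @tdom_open _ _ _ B i.
have sN := smooth_onM oU (@smooth_on_cst _ _ _ (-1)) (sY i k).
apply: (smooth_on_eq oU _ (smooth_onD oU (sX i k) sN)) => x _.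
by rewrite linearB !mxE mulN1r.
Qed.

Lemma pairing_smooth (a : sections (dual B)) X : smooth_section a -> smooth_section X ->
  smooth_on setT (pairing a X).
Proof.
move=> sa sX; apply: (smooth_on_cover (@tdom_cover _ _ _ B)) => i.
have oU := @tdom_open _ _ _ B i.
apply: (smooth_on_eq oU _ (smooth_on_sum (index_enum 'I_n) (Q := xpredT) oU
  (fun k _ => smooth_onM oU (sX i k) (sa i k)))) => x ix.
rewrite /pairing -[in RHS](trivK ix (X x)) [in RHS](row_sum_delta (triv i x (X x))).
rewrite !linear_sum /=; apply: eq_bigr => k _.
by rewrite 2!linearZ /= /dual_triv lfunE mxE.
Qed.

End SmoothSections.

(** * Bump functions and extension of vectors to global sections *)

Section SectionThrough.
Variables (R : realType) (S : manifold R).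

(** In a chart around [x0], compose [exp (-1/u)] with [r^2 - |y - c|^2]. This is non-zero only over
    a compact box inside the chart, and compact sets are closed in a Hausdorff space, so extension
    by 0 is smooth. *)
Lemma exists_bump (x0 : S) (O : set S) : open O -> O x0 ->
  exists2 b : cinf S, b x0 != 0 &
    exists2 K, closed K /\ K `<=` O & forall x, ~ K x -> b x = 0.
Proof.
move=> oO Ox0; have [i ix0] := mdom_cover x0; pose c := mchart i x0.
have Wc : (mchart i @` (O `&` mdom i)) c by exists x0.
have := open_nbhs_nbhs (conj (@chart_image_open _ _ i _ oO) Wc).
rewrite -nbhs_ballE => -[e /= e0 eW]; pose r := e / 2.
have r0 : 0 < r by rewrite divr_gt0.
(* Balls of row vectors are taken in the sup norm, so a closed box of half-width [r = e / 2] lies in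
   the ball of radius [e]; it is compact as a product of segments. *)
pose box := [set y : 'rV[R]_(mdim S) | forall l, `[c 0 l - r, c 0 l + r]%classic (y 0 l)].
have boxW : box `<=` mchart i @` (O `&` mdom i).
  move=> y by_; apply: eW; split=> // a l; rewrite (ord1 a) /ball /= distrC.
  apply: le_lt_trans (_ : r < e); last by rewrite /r; lra.
  have := by_ l; rewrite /= in_itv /= ler_norml => /andP[? ?]; apply/andP; split; lra.
have cbox : compact box.
  apply: (@rV_compact R _ (fun l => `[c 0 l - r, c 0 l + r]%classic)) => l.
  exact: segment_compact.
pose K := mchartV i @` box.
have cK : closed K.
  apply: compact_closed; first exact: mhausdorff.
  apply: continuous_compact => //; apply/continuous_in_subspaceT => y.
  rewrite inE => /boxW [x [_ ix] <-]; apply: mchartV_continuous; by exists x.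
have KO : K `<=` O `&` mdom i.
  by move=> _ [y /boxW [x [Ox ix] <-] <-]; rewrite mchartK.
pose q x := r ^+ 2 - \sum_l (mchart i x 0 l - c 0 l) * (mchart i x 0 l - c 0 l).
pose b x := if pselect (mdom i x) then flat 1 (q x) else 0.
have b0 x : ~ K x -> b x = 0.
  rewrite /b; case: pselect => // ix nK; rewrite /flat; case: ifP => // q0.
  case: nK; exists (mchart i x); last exact: mchartK.
  move=> l; have ql : (mchart i x 0 l - c 0 l) ^+ 2 < r ^+ 2.
    have := q0; rewrite /q subr_gt0 => /(le_lt_trans _); apply.
    rewrite (bigD1 l) //= expr2 lerDl sumr_ge0 // => j _; exact: sqr_ge0.
  by move: ql r0; rewrite !expr2 /= in_itv /= => ? ?; apply/andP; split; nra.
have oi := @mdom_open _ S i.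
have qs : smooth_on (mdom i) q.
  have sN g : smooth_on (mdom i) g -> smooth_on (mdom i) (fun x => - g x).
    move=> sg; apply: (smooth_on_eq oi _ (smooth_onM oi (@smooth_on_cst _ _ _ (-1)) sg)).
    by move=> x _; rewrite mulN1r.
  apply: smooth_onD => //; first exact: smooth_on_cst.
  apply: sN; apply: smooth_on_sum => // l _.
  by apply: smooth_onM => //; apply: smooth_onD => //;
    [exact: smooth_on_chart|exact: smooth_on_cst|exact: smooth_on_chart|exact: smooth_on_cst].
have bs : smooth_on setT b.
  (* Two open sets cover the manifold: the chart domain, where [b] is the composite, and the
     complement of [K], where it vanishes. *)
  apply: (@smooth_on_cover _ _ bool (fun d => if d then mdom i else ~` K)).
    by move=> x; have [/KO[_ ix]|nK] := pselect (K x); [exists true|exists false].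
  case; last first.
    apply: (smooth_on_eq _ _ (@smooth_on_cst _ _ _ 0)); first exact: closed_openC.
    by move=> x /b0.
  have sf : smooth_on (mdom i) (flat 1 \o q).
    by apply: (smooth_on_comp (@flat_stable R)) => //; exists 1.
  by apply: (smooth_on_eq oi _ sf) => x ix; rewrite /b; case: pselect.
have bx0 : b x0 != 0.
  rewrite /b; case: pselect => //= _; rewrite /q big1 => [|l _]; last by rewrite subrr mulr0.
  by rewrite subr0 /flat exprn_gt0 // hornerC mul1r gt_eqF // expR_gt0.
by exists (Cinf bs) => //; exists K; first by split => // x /KO[].
Qed.

(* The bracket on the dual bundle is only known through its pairings with global
   sections, so vectors have to be extended to global sections. *)
Lemma section_through n (B : vbundle S n) (x0 : S) (v : fib B x0) :
  exists2 X : sections B, smooth_section X & X x0 = v.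
Proof.
have [i ix0] := tdom_cover B x0.
have [b b0 [K [cK Ki] bK]] := exists_bump (@tdom_open _ _ _ B i) ix0.
pose w := (b x0)^-1 *: triv i x0 v.
exists (fun x => b x *: trivV i x w); last first.
  by rewrite linearZ /= trivK // scalerA divff // scale1r.
move=> j k; have oj := @tdom_open _ _ _ B j; have oi := @tdom_open _ _ _ B i.
(* Over [tdom i] the coordinates are [b] times combinations of transition functions; off the closed
   set [K] they are 0. *)
apply: (@smooth_on_sub _ _ (\bigcup_d (if d then tdom j `&` tdom i else tdom j `&` ~` K))).
  move=> x jx; have [/Ki ix|nK] := pselect (K x); first by exists true.
  by exists false.
apply: smooth_on_bigcup; case; last first.
  apply: (smooth_on_eq _ _ (@smooth_on_cst _ _ _ 0)); first exact: openI (closed_openC _).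
  by move=> x [_ /bK ->]; rewrite scale0r linear0 mxE.
have oU : open (tdom j `&` tdom i) by exact: openI.
have sT l : smooth_on (tdom j `&` tdom i) (fun x => triv j x (trivV i x (delta_mx 0 l)) 0 k).
  by rewrite setIC; exact: ttransition.
have sb : smooth_on (tdom j `&` tdom i) b := smooth_on_sub (@subsetT _ _) (@cinf_smooth _ _ b).
have sS := smooth_on_sum (index_enum 'I_n) (Q := xpredT) oU
  (fun l _ => smooth_onM oU (@smooth_on_cst _ _ _ (w 0 l)) (sT l)).
apply: (smooth_on_eq oU _ (smooth_onM oU sb sS)) => x _.
rewrite [in RHS](row_sum_delta w) linearZ mxE !linear_sum /= summxE.
by congr (_ * _); apply: eq_bigr => l _; rewrite linearZ /= linearZ /= [RHS]mxE.
Qed.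

End SectionThrough.

(** * Smooth functions on the cylinder and their time slices *)

Section CylinderFunctions.
Variables (R : realType) (M : manifold R).

Lemma row_mx_line m (h t : R) (u y : 'rV[R]_m) :
  h *: row_mx u 0 + row_mx y (const_mx t) = row_mx (h *: u + y) (const_mx t : 'rV_1).
Proof. by rewrite scale_row_mx add_row_mx scaler0 add0r. Qed.

Lemma delta_mx_lshift m (j : 'I_m) :
  delta_mx 0 (lshift 1 j) = row_mx (delta_mx 0 j) 0 :> 'rV[R]_(m + 1).
Proof.
apply/rowP => l; case: (split_ordP l) => a ->; rewrite ?row_mxEl ?row_mxEr !mxE.
  by rewrite (inj_eq (@lshift_inj _ _)).
by rewrite eq_rlshift andbF.
Qed.

(** Freezing the last coordinate commutes with differentiation in the first [m] directions, which
    drives the induction on [k]. *)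
Lemma Ck_row_mx m k (U : set 'rV[R]_m) (F : 'rV[R]_(m + 1) -> R) (t : R) :
  Ck k [set y | U (lsubmx y)] F -> Ck k U (fun z => F (row_mx z (const_mx t))).
Proof.
have cr (z : 'rV[R]_m) : {for z, continuous (fun z => row_mx z (const_mx t : 'rV_1))}.
  apply: (row_cvg (nbhs_filter z)) => l; case: (split_ordP l) => a ->.
    under eq_fun do rewrite row_mxEl; rewrite row_mxEl; exact: coord_continuous.
  by under eq_fun do rewrite row_mxEr; rewrite row_mxEr; exact: cvg_cst.
have Ul z : U z -> U (lsubmx (row_mx z (const_mx t : 'rV_1))) by rewrite row_mxKl.
have comp (G : 'rV[R]_(m + 1) -> R) : (forall y, U (lsubmx y) -> {for y, continuous G}) ->
    forall z, U z -> {for z, continuous (fun z => G (row_mx z (const_mx t)))}.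
  move=> cG z /Ul Uz; apply: (@continuous_comp _ _ _ (fun z => row_mx z (const_mx t : 'rV_1)) G).
    exact: cr.
  exact: cG.
elim: k F => [|k IH] F [cF dF]; split; [exact: comp|by []|exact: comp|] => j.
have [d1 d2] := dF (lshift 1 j).
have E z : (fun h : R => h^-1 *: (((fun z => F (row_mx z (const_mx t))) \o shift z)
    (h *: delta_mx 0 j) - F (row_mx z (const_mx t)))) =
  (fun h : R => h^-1 *: ((F \o shift (row_mx z (const_mx t)))
    (h *: delta_mx 0 (lshift 1 j)) - F (row_mx z (const_mx t)))).
  by apply/funext => h /=; rewrite delta_mx_lshift row_mx_line.
split; first by move=> z /Ul /d1; rewrite /derivable E.
have -> : (fun z => 'D_(delta_mx 0 j) (fun z => F (row_mx z (const_mx t))) z) =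
    (fun z => 'D_(delta_mx 0 (lshift 1 j)) F (row_mx z (const_mx t))).
  by apply/funext => z; rewrite /derive E.
exact: (IH _ d2).
Qed.

Lemma smooth_slice (F : cinf (cylinder M)) t : smooth_on setT (fun x : M => F (x, t)).
Proof.
move=> i k; have := @cinf_smooth _ _ F i k.
change (Ck k (cyl_chart (i : matlas M) @` [set p : M * R | (setT `&` @mdom _ M i) p.1])
  (fun y => F (cyl_chartV i y)) -> Ck k (mchart i @` (setT `&` mdom i))
  (fun y => F (mchartV i y, t))).
rewrite cyl_chart_image => /(@Ck_row_mx _ _ _ _ t).
by under eq_fun do rewrite /cyl_chartV row_mxKl row_mxKr mxE.
Qed.

Lemma smooth_cyl_mul (f : R -> R) (g : M -> R) (S : set (R -> R)) :
  derive_stable S -> S f -> smooth_on setT g ->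
  smooth_on (S := cylinder M) setT (fun p => f p.2 * g p.1).
Proof.
move=> HS Sf sg; apply: smooth_onM; first exact: openT.
  apply: (smooth_on_comp HS Sf); first exact: openT.
  exact: smooth_on_snd.
exact: smooth_on_fst sg.
Qed.

End CylinderFunctions.

(** * Exterior algebra and the Schouten bracket *)

Section Wedge.
Variables (R : realType) (V : Type).
Implicit Types (p q : seq V -> R) (s : seq V).

Lemma big_tuple_bool n (F : seq bool -> R) :
  \sum_(m : n.+1.-tuple bool) F m =
  \sum_(m : n.-tuple bool) F (true :: m) + \sum_(m : n.-tuple bool) F (false :: m).
Proof.
pose h (bm : bool * n.-tuple bool) : n.+1.-tuple bool := [tuple of bm.1 :: bm.2].
pose h' (m : n.+1.-tuple bool) := (thead m, [tuple of behead m]).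
have hK : cancel h h'.
  by move=> [b m]; congr pair; apply: val_inj.
have h'K : cancel h' h by move=> m; rewrite [RHS]tuple_eta; exact: val_inj.
rewrite (reindex h) /=; last by exists h' => ? _.
rewrite -(pair_bigA _ (fun (b : bool) (m : n.-tuple bool) => F (b :: m))) /=.
by rewrite big_bool.
Qed.

Lemma wedge_nil p q : wedge p q [::] = p [::] * q [::].
Proof.
rewrite /wedge (bigD1 [tuple]) //= big1 ?addr0 ?mul1r // => m.
by case/eqP; exact: tuple0.
Qed.

(** The shuffles are split by the destination of [v]: sent to [q], it has to pass every argument of
    [p], whence the sign. *)
Lemma wedge_cons p q v s : wedge p q (v :: s) =
  wedge (fun t => p (v :: t)) q s +
  wedge (fun t => (-1) ^+ size t * p t) (fun t => q (v :: t)) s.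
Proof.
rewrite /wedge /= (big_tuple_bool (size s) (fun m =>
  (-1) ^+ shuffle_inv m * p (mask m (v :: s)) * q (mask (map negb m) (v :: s)))) /=.
congr (_ + _); apply: eq_bigr => m _.
by rewrite exprD size_mask ?size_tuple // !mulrA [_ * (-1) ^+ _ in RHS]mulrC.
Qed.

Lemma wedge0l q s : wedge (fun=> 0) q s = 0.
Proof. by rewrite /wedge big1 // => m _; rewrite mulr0 mul0r. Qed.

Lemma wedge0r p s : wedge p (fun=> 0) s = 0.
Proof. by rewrite /wedge big1 // => m _; rewrite mulr0. Qed.

Lemma wedgeZ a b p q s :
  wedge (fun t => a * p t) (fun t => b * q t) s = a * b * wedge p q s.
Proof. by rewrite /wedge mulr_sumr; apply: eq_bigr => m _; ring. Qed.

Lemma wedge_scalarl c q s : wedge (fun t => if t is [::] then c else 0) q s = c * q s.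
Proof.
elim: s q => [|v s IH] q; first by rewrite wedge_nil.
rewrite wedge_cons wedge0l add0r -[RHS](IH (fun t => q (v :: t))).
by congr (wedge _ _ s); apply/funext => -[|u t] //=; rewrite ?mul1r ?mulr0.
Qed.

Lemma wedge_scalarr p c s : wedge p (fun t => if t is [::] then c else 0) s = p s * c.
Proof.
elim: s p => [|v s IH] p; first by rewrite wedge_nil.
by rewrite wedge_cons wedge0r addr0 IH.
Qed.

Definition covector_like q := forall t, size t <> 1%N -> q t = 0.

Lemma covector_like_cons q u : covector_like q ->
  (fun t => q (u :: t)) = fun t => if t is [::] then q [:: u] else 0.
Proof. by move=> Hq; apply/funext => -[|w t] //; rewrite Hq. Qed.

(** As [q] kills every entry of [s], only the shuffle handing [v] to [q] survives; [v] being last,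
    it carries no sign. The intended use is [q = dt], [v = d/dt]. *)
Lemma wedge_rcons p q s v : covector_like q -> List.Forall (fun u => q [:: u] = 0) s ->
  wedge p q (rcons s v) = p s * q [:: v].
Proof.
move=> Hq; elim: s p => [|u s IH] p Hs.
  by rewrite /= wedge_cons !wedge_nil mul1r (Hq [::]) // mulr0 add0r.
have [qu Hs'] := (List.Forall_inv Hs, List.Forall_inv_tail Hs).
by rewrite /= wedge_cons IH // covector_like_cons // qu wedge_scalarr mulr0 addr0.
Qed.

(** Here [q] may be non-zero on [z] too, but the shuffle handing [z] to [q] leaves [v] among the
    arguments of [p], where the last hypothesis makes it vanish. *)
Lemma wedge_rcons_mid p q s1 z s2 v : covector_like q ->
  List.Forall (fun u => q [:: u] = 0) s1 -> List.Forall (fun u => q [:: u] = 0) s2 ->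
  p (s1 ++ rcons s2 v) = 0 ->
  wedge p q (rcons (s1 ++ z :: s2) v) = p (s1 ++ z :: s2) * q [:: v].
Proof.
move=> Hq Hs1 Hs2; elim: s1 p Hs1 => [|u s IH] p Hs p0.
  rewrite /= wedge_cons wedge_rcons // covector_like_cons // wedge_scalarr.
  by rewrite (p0 : p (rcons s2 v) = 0) mulr0 mul0r addr0.
have [qu Hs'] := (List.Forall_inv Hs, List.Forall_inv_tail Hs).
by rewrite /= wedge_cons IH // covector_like_cons // qu wedge_scalarr mulr0 addr0.
Qed.

End Wedge.

(** * Multivectors and their brackets with a section *)

Section Multivectors.
Variables (R : realType) (S : manifold R) (n : nat) (B : vbundle S n).
Implicit Types (P Q : mvec B) (a : sections B).

Lemma mvec_ext P Q : (forall x s, P x s = Q x s) -> P = Q.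
Proof. by move=> PQ; apply/functional_extensionality_dep => x; apply/funext. Qed.

Definition decomposable p (X : 'I_p -> sections B) : mvec B :=
  \big[@mwedge R S n B/mvec_fun (fun=> 1)]_(j < p) mvec_sec (X j).

Arguments decomposable {p} X x s.

Lemma decomposable0 (X : 'I_0 -> sections B) : decomposable X = mvec_fun (fun=> 1).
Proof. by rewrite /decomposable big_ord0. Qed.

Lemma decomposableS p (X : 'I_p.+1 -> sections B) :
  decomposable X = mwedge (mvec_sec (X ord0)) (decomposable (fun j => X (lift ord0 j))).
Proof. by rewrite /decomposable big_ord_recl. Qed.

Definition smooth_cst c : cinf S := Cinf (@smooth_on_cst R S setT c).

Lemma multivector_scale p (f : cinf S) (X : 'I_p -> sections B) :
  (forall j, smooth_section (X j)) ->
  multivector p (fun x s => f x * decomposable X x s).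
Proof.
move=> sX; exists 1%N, (fun=> f), (fun=> X); split=> // x s.
by rewrite big_ord1.
Qed.

Lemma multivector_decomposable p (X : 'I_p -> sections B) :
  (forall j, smooth_section (X j)) -> multivector p (decomposable X).
Proof.
move=> /(multivector_scale (smooth_cst 1)).
by congr multivector; apply: mvec_ext => x s; rewrite mul1r.
Qed.

Lemma multivector_sec a : smooth_section a -> multivector 1 (mvec_sec a).
Proof.
move=> sa; have := @multivector_decomposable 1 (fun=> a) (fun=> sa).
rewrite decomposableS decomposable0; congr multivector; apply: mvec_ext => x s.
by rewrite /mwedge wedge_scalarr mulr1.
Qed.

Lemma multivector_fun (f : cinf S) : multivector 0 (@mvec_fun R S n B f).
Proof.
have := @multivector_scale 0 f (fun=> fun=> 0) _.
rewrite decomposable0 => H.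
have /H : forall j : 'I_0, smooth_section (fun x : S => 0 : fib B x) by case.
congr multivector; apply: mvec_ext => x [|u s]; rewrite /mvec_fun /= ?mulr1 ?mulr0 //.
Qed.

Variables (L : lie_algebroid B) (SB : schouten L).

Lemma sbr0 p P : multivector p P ->
  forall x (s : seq (fib (dual B) x)), sbr SB P (fun _ _ => 0) s = 0.
Proof.
move=> mP x s.
have m0 : multivector 0 (fun (x : S) (s : seq (fib (dual B) x)) => 0 : R).
  exists 0%N, (fun=> smooth_cst 0), (fun _ _ _ => 0); split; first by case.
  by move=> y t; rewrite [RHS]big_ord0.
have := sbrD SB mP m0 m0 s.
rewrite (_ : (fun y t => 0 + 0) = fun _ _ => 0); last by apply: mvec_ext => y t; rewrite addr0.
by move=> /eqP; rewrite addrC -subr_eq subrr => /eqP/esym.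
Qed.

(** [f * Q] is the wedge of the degree-0 element [f] with [Q], so this is the Leibniz rule, with
    sign exponent 0. *)
Lemma sbr_sec_scale p a (f : cinf S) Q : smooth_section a -> multivector p Q ->
  forall x (s : seq (fib (dual B) x)),
  sbr SB (mvec_sec a) (fun y t => f y * Q y t) s =
  lanc L a f x * Q x s + f x * sbr SB (mvec_sec a) Q s.
Proof.
move=> sa mQ x s.
rewrite (_ : (fun y t => _) = mwedge (mvec_fun f) Q); last first.
  by apply: mvec_ext => y t; rewrite /mwedge wedge_scalarl.
rewrite (sbr_leibniz SB (multivector_sec sa) (multivector_fun f) mQ) /= mul1r.
rewrite (_ : sbr SB (mvec_sec a) (mvec_fun f) = mvec_fun (lanc L a f)).
  by rewrite /mwedge !wedge_scalarl.
by apply: mvec_ext => y t; exact: sbr_sec_fun.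
Qed.

Lemma sbr_sec_decomposableS p a (X : 'I_p.+1 -> sections B) :
  smooth_section a -> (forall j, smooth_section (X j)) ->
  forall x (s : seq (fib (dual B) x)),
  sbr SB (mvec_sec a) (decomposable X) s =
  mwedge (mvec_sec (lbr L a (X ord0))) (decomposable (fun j => X (lift ord0 j))) s +
  mwedge (mvec_sec (X ord0))
    (sbr SB (mvec_sec a) (decomposable (fun j => X (lift ord0 j)))) s.
Proof.
move=> sa sX x s; rewrite decomposableS.
rewrite (sbr_leibniz SB (multivector_sec sa) (multivector_sec (sX ord0))
  (multivector_decomposable (fun j => sX (lift ord0 j)))) /=.
rewrite muln1 sqrrN expr1n mul1r.
rewrite (_ : sbr SB _ (mvec_sec (X ord0)) = mvec_sec (lbr L a (X ord0))) //.
by apply: mvec_ext => y t; exact: sbr_sec_sec.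
Qed.

(** The bracket is additive for two multivectors at a time, so summands are split off one by one. *)
Lemma sbr_sec_sum p a N (f : 'I_N -> cinf S) (X : 'I_N -> 'I_p -> sections B) :
  smooth_section a -> (forall k j, smooth_section (X k j)) ->
  forall x (s : seq (fib (dual B) x)),
  sbr SB (mvec_sec a) (fun y t => \sum_k f k y * decomposable (X k) y t) s =
  \sum_k (lanc L a (f k) x * decomposable (X k) x s
          + f k x * sbr SB (mvec_sec a) (decomposable (X k)) s).
Proof.
move=> sa; elim: N f X => [|N IH] f X sX x s.
  rewrite (_ : (fun y t => _) = fun _ _ => 0); last by apply: mvec_ext => y t; rewrite big_ord0.
  by rewrite (sbr0 (multivector_sec sa)) big_ord0.
rewrite (_ : (fun y t => _) = fun y t =>
  f ord0 y * decomposable (X ord0) y t +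
  \sum_(k < N) f (lift ord0 k) y * decomposable (X (lift ord0 k)) y t); last first.
  by apply: mvec_ext => y t; rewrite big_ord_recl.
rewrite (sbrD SB (multivector_sec sa) (multivector_scale (f ord0) (sX ord0))); last first.
  by exists N, (fun k => f (lift ord0 k)), (fun k => X (lift ord0 k)).
rewrite (sbr_sec_scale (f ord0) sa (multivector_decomposable (sX ord0))) IH //.
by rewrite big_ord_recl.
Qed.

Lemma wedge_bivector (X Y : sections B) x (a b : fib (dual B) x) :
  mwedge (mvec_sec X) (mwedge (mvec_sec Y) (mvec_fun (fun=> 1))) [:: a; b] =
  (a : 'Hom(fib B x, R^o)) (X x) * (b : 'Hom(fib B x, R^o)) (Y x)
  - (b : 'Hom(fib B x, R^o)) (X x) * (a : 'Hom(fib B x, R^o)) (Y x).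
Proof.
rewrite /mwedge (_ : wedge (@mvec_sec R S n B Y x) _ = @mvec_sec R S n B Y x); last first.
  by apply/funext => t; rewrite wedge_scalarr mulr1.
by rewrite !wedge_cons !wedge_nil /=; ring.
Qed.

End Multivectors.

Arguments decomposable {R S n B p} X x s.

(** * The induced algebroid on the cylinder *)

Section Sharp.
Variables (R : realType) (S : manifold R) (n : nat) (B : vbundle S n).

Lemma dual_separates x (v w : fib B x) :
  (forall b : 'Hom(fib B x, R^o), b v = b w) -> v = w.
Proof.
have [i ix] := tdom_cover B x => vw; apply: (can_inj (trivK ix)); apply/rowP => k.
have := vw (covector (triv i x) (delta_mx 0 k)); rewrite !covectorE.
have E (u : fib B x) : \sum_l (delta_mx 0 k : 'rV[R]_n) 0 l * triv i x u 0 l = triv i x u 0 k.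
  rewrite (bigD1 k) //= mxE !eqxx mul1r big1 ?addr0 // => l lk.
  by rewrite mxE (negPf lk) andbF mul0r.
by rewrite !E.
Qed.

(** Covectors separate vectors, so the choice made in [sharp] is unique; exhibiting [v] rules out
    the default value 0. *)
Lemma sharp_eq (P : mvec B) (a : sections (dual B)) x (v : fib B x) :
  (forall b : 'Hom(fib B x, R^o), b v = P x [:: a x; b]) -> sharp P a x = v.
Proof.
move=> Hv; rewrite /sharp; case: xgetP => [w _ Hw|/(_ v)]; last by case.
by apply: dual_separates => b; rewrite Hv Hw.
Qed.

Lemma bivectorE (P : mvec B) : multivector 2 P ->
  exists N (f : 'I_N -> cinf S) (X Y : 'I_N -> sections B),
  [/\ forall k, smooth_section (X k), forall k, smooth_section (Y k) &
    forall x (a b : 'Hom(fib B x, R^o)), P x [:: a; b] =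
      \sum_k f k x * (a (X k x) * b (Y k x) - b (X k x) * a (Y k x))].
Proof.
move=> [N [f [X [sX PE]]]].
exists N, f, (fun k => X k ord0), (fun k => X k (lift ord0 ord0)); split=> // x a b.
rewrite PE; apply: eq_bigr => k _; congr (_ * _).
change (decomposable (X k) x [:: a; b] = a (X k ord0 x) * b (X k (lift ord0 ord0) x)
  - b (X k ord0 x) * a (X k (lift ord0 ord0) x)).
by rewrite 2!decomposableS decomposable0 wedge_bivector.
Qed.

(** Writing [P] as a sum of terms [f X /\ Y] gives [P^# a] as the sum of [f (a(X) Y - a(Y) X)],
    which is visibly smooth. *)
Lemma sharp_smooth (P : mvec B) a : multivector 2 P -> smooth_section a ->
  smooth_section (sharp P a).
Proof.
move=> /bivectorE[N [f [X [Y [sX sY PE]]]]] sa.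
rewrite (_ : sharp P a = fun x => \sum_k (f k x *:
    (pairing a (X k) x *: Y k x - pairing a (Y k) x *: X k x))); last first.
  apply/functional_extensionality_dep => x; apply: sharp_eq => b.
  rewrite PE linear_sum; apply: eq_bigr => k _.
  rewrite linearZ linearB !linearZ /= /pairing /GRing.scale /=; ring.
apply: smooth_section_sum => k; apply: smooth_sectionZ; first exact: cinf_smooth.
by apply: smooth_sectionB; apply: smooth_sectionZ => //; exact: pairing_smooth.
Qed.

Lemma sharpE (P : mvec B) (a : sections (dual B)) x (b : 'Hom(fib B x, R^o)) :
  multivector 2 P -> b (sharp P a x) = P x [:: a x; b].
Proof.
move=> /bivectorE[N [f [X [Y [_ _ PE]]]]].
rewrite (@sharp_eq P a x (\sum_k (f k x *:
    (pairing a (X k) x *: Y k x - pairing a (Y k) x *: X k x)))).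
  rewrite PE linear_sum; apply: eq_bigr => k _.
  rewrite linearZ linearB !linearZ /= /pairing /GRing.scale /=; ring.
move=> c; rewrite PE linear_sum; apply: eq_bigr => k _.
rewrite linearZ linearB !linearZ /= /pairing /GRing.scale /=; ring.
Qed.

Lemma bivectorC (P : mvec B) x (a b : 'Hom(fib B x, R^o)) : multivector 2 P ->
  P x [:: a; b] = - P x [:: b; a].
Proof.
move=> /bivectorE[N [f [X [Y [_ _ PE]]]]]; rewrite !PE -sumrN.
by apply: eq_bigr => k _; ring.
Qed.

Lemma bivectorZ (P : mvec B) x c d (a b : 'Hom(fib B x, R^o)) : multivector 2 P ->
  P x [:: c *: a; d *: b] = c * d * P x [:: a; b].
Proof.
move=> /bivectorE[N [f [X [Y [_ _ PE]]]]]; rewrite !PE mulr_sumr.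
by apply: eq_bigr => k _; rewrite !scale_lfunE /GRing.scale /=; ring.
Qed.

End Sharp.

(** * Anchors and brackets of the sections [e^t alpha] *)

Section Cylinder.
Variables (R : realType) (M : manifold R) (n : nat) (A : vbundle M n).

Lemma exp_family_scale c : exp_family (fun u : R => expR (c * u)).
Proof. by exists 1, c; apply/funext => u; rewrite mul1r. Qed.

Definition exp_cinf c (h : cinf M) : cinf (cylinder M) :=
  Cinf (smooth_cyl_mul (@exp_stable R) (exp_family_scale c) (@cinf_smooth _ _ h)).

Lemma pull_section_smooth (X : sections A) : smooth_section X -> smooth_section (pull_section X).
Proof. by move=> sX i k; exact: smooth_on_fst (sX i k). Qed.

Definition exp_section (a : sections (dual A)) : sections (dual (pull A)) :=
  fun p => expR p.2 *: (a p.1 : 'Hom(fib A p.1, R^o)).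

Lemma exp_section_smooth (a : sections (dual A)) : smooth_section a ->
  smooth_section (exp_section a).
Proof.
move=> sa; apply: (@smooth_sectionZ _ _ _ (dual (pull A)) (fun p => expR p.2) (fun p => a p.1)).
  have := smooth_cyl_mul (@exp_stable R) (exp_family_scale 1) (@smooth_on_cst _ M setT 1).
  by congr smooth_on; apply/funext => p; rewrite mulr1 mul1r.
by move=> i k; have := smooth_on_fst (sa i k).
Qed.

Lemma pairing_exp_section (a : sections (dual A)) (X : sections A) :
  pairing (exp_section a) (pull_section X) = fun p => expR (1 * p.2) * pairing a X p.1.
Proof. by apply/funext => p; rewrite /pairing scale_lfunE mul1r. Qed.

Variables (LA : lie_algebroid A) (phi0 : sections (dual A)).
Variables (LAh : lie_algebroid (pull A)) (HAh : induced_hat LA phi0 LAh).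

(** [rho(X)] acts on [h] and [phi0(X) d/dt] on the exponential. For [c = 1] the right-hand factor is
    the twisted differential [d^phi0 h] on [X]. *)
Lemma lanc_hat (X : sections A) c (h : cinf M) x t : smooth_section X ->
  lanc LAh (pull_section X) (fun p => expR (c * p.2) * h p.1) (x, t) =
  expR (c * t) * (lanc LA X h x + c * pairing phi0 X x * h x).
Proof.
move=> sX; have [_ H] := HAh; rewrite (H X (exp_cinf c h)) //=.
rewrite vector_fieldZ; last exact: lanc_vector_field.
have [d1 d2] := exp_derive_lin (h x) c t.
rewrite (_ : (fun r => _) = fun u => h x * expR (c * u)); last by apply/funext => u; rewrite mulrC.
by rewrite derive1E d2; ring.
Qed.

(** The pairings involved are [e^t] times functions on [M], so by [lanc_hat] with [c = 1] each
    untwisted derivative upstairs supplies the corresponding [phi0] term downstairs. *)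
Lemma lie_tw_hat (Z X : sections A) (b : sections (dual A)) x t :
  smooth_section Z -> smooth_section X -> smooth_section b ->
  lie_tw LAh (fun=> 0) (pull_section Z) (exp_section b) (pull_section X) (x, t) =
  expR t * lie_tw LA phi0 Z b X x.
Proof.
move=> sZ sX sb; have [H _] := HAh.
pose bX := Cinf (pairing_smooth sb sX); pose bZ := Cinf (pairing_smooth sb sZ).
rewrite /lie_tw /d1_tw /d0_tw /d1 /d0 !pairing_exp_section.
rewrite (lanc_hat _ bX) // (lanc_hat _ bZ) //=.
rewrite /pairing H //= !scale_lfunE !lfunE /= !mul1r /GRing.scale /=; ring.
Qed.

Variables (P : mvec A) (mP : multivector 2 P).
Let Ph : mvec (pull A) := fun p s => expR (- p.2) * @P p.1 s.

(** The factor [e^t] of the section cancels the factor [e^{-t}] of the bivector; the rescaling is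
    chosen for this. *)
Lemma sharp_hat (a : sections (dual A)) :
  sharp Ph (exp_section a) = pull_section (sharp P a).
Proof.
apply/functional_extensionality_dep => -[x t]; apply: sharp_eq => b.
transitivity (@P x [:: a x; b]); first exact: (@sharpE _ _ _ A P a x b mP).
change (@P x [:: a x; b] = expR (- t) * @P x [:: expR t *: (a x : 'Hom(fib A x, R^o)); b]).
have := bivectorZ (expR t) 1 (a x) b mP; rewrite scale1r => ->.
by rewrite mulr1 mulrA -expRD addNr expR0 mul1r.
Qed.

Variables (LAd : lie_algebroid (dual A)) (HAd : induced_dual LA phi0 P LAd).
Variables (LAhd : lie_algebroid (dual (pull A))) (HAhd : induced_dual LAh (fun=> 0) Ph LAhd).

Lemma lanc_dual_hat (a : sections (dual A)) c (h : cinf M) x t : smooth_section a ->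
  lanc LAhd (exp_section a) (fun p => expR (c * p.2) * h p.1) (x, t) =
  expR (c * t) * (lanc LAd a h x + c * pairing phi0 (sharp P a) x * h x).
Proof.
move=> sa; have [[_ Hd] [_ Hhd]] := (HAd, HAhd).
rewrite (Hhd _ (exp_cinf c h)) ?sharp_hat /=; last exact: exp_section_smooth.
by rewrite lanc_hat ?Hd //; exact: sharp_smooth.
Qed.

Lemma lbr_dual_hat (a b : sections (dual A)) x t : smooth_section a -> smooth_section b ->
  lbr LAhd (exp_section a) (exp_section b) (x, t) = exp_section (lbr LAd a b) (x, t).
Proof.
move=> sa sb; apply/lfunP => v; have [X sX Xx] := @section_through _ _ _ A x v.
have [[Hd _] [Hhd _]] := (HAd, HAhd).
have := Hhd _ _ _ (x, t) (exp_section_smooth sa) (exp_section_smooth sb) (pull_section_smooth sX).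
rewrite {1}/pairing /= [pull_section X _]Xx => ->.
have := Hd _ _ _ x sa sb sX; rewrite {1}/pairing /= Xx => E.
rewrite scale_lfunE E !sharp_hat !lie_tw_hat //; [|exact: sharp_smooth..].
(* Two factors [e^t] against one [e^{-t}] leave [e^t P(a, b)], so [lanc_hat] applies with
   [c = 1]. *)
have PE : (fun p : cylinder M => @Ph p [:: exp_section a p; exp_section b p]) =
    fun p => expR (1 * p.2) * pairing b (sharp P a) p.1.
  apply/funext => p; rewrite /pairing sharpE // /Ph bivectorZ // mul1r !mulrA -expRD.
  by rewrite addNr expR0 mul1r.
have sP := pairing_smooth sb (sharp_smooth mP sa).
rewrite PE /d0_tw /d0 (lanc_hat _ (Cinf sP)) //=.
rewrite (_ : (fun y => @P y [:: a y; b y]) = pairing b (sharp P a)); last first.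
  by apply/funext => y; rewrite /pairing sharpE.
rewrite [pairing (fun=> 0) _ _]lfunE /= mul1r /GRing.scale /=.
by rewrite (_ : @P x [:: a x; b x] = pairing b (sharp P a) x); [ring|rewrite /pairing sharpE].
Qed.

End Cylinder.

(** * Modular forms on the cylinder *)

Section ScaledLift.
Variables (R : realType) (M : manifold R) (n : nat) (A : vbundle M n).
Variables (L : lie_algebroid (dual A)) (SB : schouten L).
Variables (Lh : lie_algebroid (dual (pull A))) (SBh : schouten Lh).
Variable g : sections (dual A) -> M -> R.
Hypothesis lancE : forall a c (h : cinf M) x t, smooth_section a ->
  lanc Lh (exp_section a) (fun p => expR (c * p.2) * h p.1) (x, t) =
  expR (c * t) * (lanc L a h x + c * g a x * h x).
Hypothesis lbrE : forall a b x t, smooth_section a -> smooth_section b ->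
  lbr Lh (exp_section a) (exp_section b) (x, t) = exp_section (lbr L a b) (x, t).

Lemma mvec_sec_exp (a : sections (dual A)) x t (s : seq (fib (dual (dual A)) x)) :
  @mvec_sec R (cylinder M) n (dual (pull A)) (exp_section a) (x, t) s =
  expR t * mvec_sec a s.
Proof. by case: s => [|u [|? ?]] /=; rewrite ?mulr0 //; exact: linearZ. Qed.

Lemma decomposable_exp p (X : 'I_p -> sections (dual A)) x t (s : seq (fib (dual (dual A)) x)) :
  @decomposable R (cylinder M) n (dual (pull A)) p (fun j => exp_section (X j)) (x, t) s =
  expR t ^+ p * decomposable X x s.
Proof.
elim: p X s => [|p IH] X s.
  by rewrite !decomposable0 expr0 mul1r.
rewrite !decomposableS exprS -wedgeZ; congr (wedge _ _ s); apply/funext => u.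
  exact: mvec_sec_exp.
exact: IH.
Qed.

(** Leibniz peels off one factor at a time and [lbrE] keeps its [e^t]; in degree 0 both sides are
    derivatives of the constant 1. *)
Lemma sbr_decomposable_exp p (a : sections (dual A)) (X : 'I_p -> sections (dual A)) x t
    (s : seq (fib (dual (dual A)) x)) :
  smooth_section a -> (forall j, smooth_section (X j)) ->
  @sbr _ _ _ _ _ SBh (mvec_sec (exp_section a))
    (decomposable (fun j => exp_section (X j))) (x, t) s =
  expR t ^+ p * sbr SB (mvec_sec a) (decomposable X) s.
Proof.
move=> sa; have sea := exp_section_smooth sa.
elim: p X s => [|p IH] X s sX.
  rewrite !decomposable0 expr0 mul1r.
  have := @sbr_sec_fun _ _ _ _ _ SBh _ (smooth_cst (cylinder M) 1) sea (x, t) s.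
  have := @sbr_sec_fun _ _ _ _ _ SB _ (smooth_cst M 1) sa x s.
  move=> /= -> ->; case: s => //=.
  by rewrite !vector_field_cst //; exact: lanc_vector_field.
have sL j : smooth_section (X (lift ord0 j)) by [].
rewrite !sbr_sec_decomposableS //; last by move=> j; exact: exp_section_smooth.
rewrite mulrDr exprS; congr (_ + _); rewrite -wedgeZ; congr (wedge _ _ s);
  apply/funext => u.
- rewrite -mvec_sec_exp /mvec_sec; case: u => [|u [|? ?]] //=; congr (u _).
  exact: lbrE.
- exact: decomposable_exp.
- exact: mvec_sec_exp.
- exact: IH.
Qed.

Lemma sbr_exp p (a : sections (dual A)) (nu : mvec (dual A)) c x t
    (s : seq (fib (dual (dual A)) x)) :
  smooth_section a -> multivector p nu ->
  @sbr _ _ _ _ _ SBh (mvec_sec (exp_section a))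
    (fun q u => expR (c * q.2) * nu q.1 u) (x, t) s =
  expR (c * t) * (sbr SB (mvec_sec a) nu s + (c - p%:R) * g a x * nu x s).
Proof.
move=> sa [N [f [X [sX nuE]]]].
have nuE' : nu = fun y u => \sum_k f k y * decomposable (X k) y u.
  by apply: mvec_ext => y u; exact: nuE.
have expn r : expR r ^+ p = expR (p%:R * r) by rewrite expRM_natl.
have cE r : expR (c * r) = expR ((c - p%:R) * r) * expR r ^+ p.
  by rewrite expn -expRD; congr expR; ring.
(* [p] of the exponential factors are absorbed into the sections; the remaining [e^{(c-p)t}] goes to
   the coefficient, where the anchor produces [(c - p) g]. *)
have hE : (fun (q : cylinder M) (u : seq (fib (dual (dual (pull A))) q)) =>
      expR (c * q.2) * nu q.1 u) =
    fun q u => \sum_k exp_cinf (c - p%:R) (f k) q *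
      decomposable (fun j => exp_section (X k j)) q u.
  apply: mvec_ext => -[y r] u /=; rewrite nuE mulr_sumr; apply: eq_bigr => k _.
  by rewrite decomposable_exp cE -/(@decomposable R M n (dual A) p (X k)) /decomposable; ring.
rewrite hE sbr_sec_sum; [|exact: exp_section_smooth|by move=> *; exact: exp_section_smooth].
rewrite nuE' sbr_sec_sum // mulr_sumr -big_split mulr_sumr /=; apply: eq_bigr => k _.
by rewrite lancE // decomposable_exp sbr_decomposable_exp // cE; ring.
Qed.

End ScaledLift.

(** * The Lie derivative of [mu /\ dt] *)

Section CylinderForms.
Variables (R : realType) (M : manifold R).
Implicit Types (Y Z : (M -> R) -> M -> R) (F : M * R -> R).

Definition lift_vf Y F (p : M * R) : R := Y (fun y => F (y, p.2)) p.1.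

Definition dt_vf F (p : M * R) : R := derive1 (fun r => F (p.1, r)) p.2.

Lemma pderiv_slice (i : matlas M) j F x t :
  @pderiv R (cylinder M) i (lshift 1 j) F (x, t) = pderiv i j (fun y => F (y, t)) x.
Proof.
rewrite /pderiv /derive; set q1 := fun h => _; set q2 := fun h => _.
suff -> : q1 = q2 by [].
apply/funext => h; rewrite /q1 /q2 /= /cyl_chart /= delta_mx_lshift row_mx_line.
by rewrite /cyl_chartV !row_mxKl !row_mxKr mxE.
Qed.

Lemma pderiv_dt (i : matlas M) F x t : mdom i x ->
  @pderiv R (cylinder M) i (rshift (mdim M) 0) F (x, t) = dt_vf F (x, t).
Proof.
move=> ix; rewrite /dt_vf derive1E /pderiv /derive; set q1 := fun h => _; set q2 := fun h => _.
suff -> : q1 = q2 by [].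
apply/funext => h; rewrite /q1 /q2 /= /cyl_chart /=.
rewrite (_ : h *: _ + _ = row_mx (mchart i x) (const_mx (h *: 1 + t) : 'rV_1)).
  by rewrite /cyl_chartV !row_mxKl !row_mxKr !mxE mchartK.
apply/rowP => l; rewrite mxE [in X in X + _]mxE [in X in _ * X]mxE.
case: (split_ordP l) => a ->; rewrite !(row_mxEl, row_mxEr).
  by rewrite eq_lrshift andbF mulr0 add0r.
by rewrite (ord1 a) !mxE !eqxx.
Qed.

Lemma lift_vector_field Y : vector_field Y -> vector_field (S := cylinder M) (lift_vf Y).
Proof.
move=> vY i; have [a sa Ya] := vY i.
exists (fun j p => if fintype.split j is inl l then a l p.1 else 0).
  move=> j; case: (fintype.split j) => [l|_]; first exact: smooth_on_fst (sa l).
  exact: smooth_on_cst.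
(* The coefficient formula of [Y] holds on smooth functions, so the slice of [F] at time [t] is
   supplied as one. *)
move=> [x t] ix F; rewrite /lift_vf /= (Ya x ix (Cinf (smooth_slice F t))) big_split_ord /=.
rewrite [X in _ + X]big1 ?addr0; last first.
  by move=> l _; rewrite (unsplitK (inr l : 'I_(mdim M) + 'I_1)) mul0r.
apply: eq_bigr => l _; rewrite (unsplitK (inl l : 'I_(mdim M) + 'I_1)).
by rewrite pderiv_slice.
Qed.

Lemma dt_vector_field : vector_field (S := cylinder M) dt_vf.
Proof.
move=> i; exists (fun j p => if fintype.split j is inl l then 0 else 1).
  by move=> j; case: (fintype.split j) => [l|_]; exact: smooth_on_cst.
move=> [x t] ix F; rewrite big_split_ord /= big1 ?add0r; last first.
  by move=> l _; rewrite (unsplitK (inl l : 'I_(mdim M) + 'I_1)) mul0r.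
by rewrite big_ord1 (unsplitK (inr 0 : 'I_(mdim M) + 'I_1)) mul1r pderiv_dt.
Qed.

Lemma Forall_map (T U : Type) (Q : T -> Prop) (Q' : U -> Prop) (f : T -> U) s :
  (forall u, Q u -> Q' (f u)) -> List.Forall Q s -> List.Forall Q' (map f s).
Proof.
move=> H; elim: s => [|u s IH] /=; first by constructor.
by case/List.Forall_cons_iff => ? ?; constructor; auto.
Qed.

(** Push-forward of tangent vectors along the projection to [M]. *)
Definition res_fst (v : cinf (cylinder M) -> R) : cinf M -> R := fun f => v (cinf_fst f).

Definition dt_form (s : seq (cinf (cylinder M) -> R)) : R :=
  if s is [:: v] then v (cinf_snd M) else 0.

Lemma dt_form_covector : covector_like dt_form.
Proof. by move=> [|u [|? ?]]. Qed.

Lemma wedge_dtE (mu : forms M) p s :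
  wedge_dt mu p s = wedge (fun u => mu p.1 (map res_fst u)) dt_form s.
Proof. by []. Qed.

Lemma dt_form_lift Ys (p : M * R) : List.Forall (@vector_field R M) Ys ->
  List.Forall (fun u => dt_form [:: u] = 0)
    (map (@tangent_at R (cylinder M) p) (map lift_vf Ys)).
Proof.
rewrite -map_comp; apply: Forall_map => Y vY.
exact: (vector_field_cst p.2 p.1 vY).
Qed.

Lemma map_res_lift Ys (p : M * R) :
  map res_fst (map (@tangent_at R (cylinder M) p) (map lift_vf Ys)) =
  map (tangent_at p.1) Ys.
Proof. by rewrite -!map_comp; exact: eq_map. Qed.

Lemma dt_form_dt (p : M * R) : dt_form [:: @tangent_at R (cylinder M) p dt_vf] = 1.
Proof. exact: derive1_id. Qed.

Lemma res_dt (p : M * R) : res_fst (@tangent_at R (cylinder M) p dt_vf) = fun=> 0.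
Proof. by apply/funext => f; exact: (derive1_cst (f p.1)). Qed.

(** The lifts are killed by [dt], while [dt] takes the value 1 on [d/dt]. *)
Lemma form_eval_cyl (mu : forms M) Ys (p : M * R) :
  List.Forall (@vector_field R M) Ys ->
  form_eval (wedge_dt mu) (rcons (map lift_vf Ys) dt_vf) p = form_eval mu Ys p.1.
Proof.
move=> vYs; rewrite /form_eval wedge_dtE map_rcons wedge_rcons.
- by rewrite map_res_lift dt_form_dt mulr1.
- exact: dt_form_covector.
- exact: dt_form_lift.
Qed.

Variables (Z : (M -> R) -> M -> R) (Zh : (M * R -> R) -> M * R -> R) (g : M -> R).
Hypothesis vZh : vector_field (S := cylinder M) Zh.
Hypothesis Zh_fst : forall (h : cinf M) p, Zh (fun q => h q.1) p = Z h p.1.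
Hypothesis Zh_snd : forall p, Zh snd p = g p.1.

(** [Zh] projects to [Z] and the lift to [Y], and brackets of projectable fields project to the
    bracket. *)
Lemma res_bracket_lift Y (p : M * R) : vector_field Y ->
  res_fst (@tangent_at R (cylinder M) p (@vf_bracket R (cylinder M) Zh (lift_vf Y))) =
  tangent_at p.1 (vf_bracket Z Y).
Proof.
move=> vY; apply/funext => h; rewrite /res_fst /tangent_at /vf_bracket; congr (_ - _).
  exact: (Zh_fst (Cinf (vector_field_smooth h vY))).
rewrite /lift_vf; congr (Y _ _); apply/funext => y; exact: Zh_fst.
Qed.

(** The value is [Zh(1) - dg/dt], and [g] does not depend on time: the [d/dt] part of [Zh] has no
    divergence. *)
Lemma dt_form_bracket_dt (p : M * R) :
  dt_form [:: @tangent_at R (cylinder M) p (@vf_bracket R (cylinder M) Zh dt_vf)] = 0.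
Proof.
rewrite /= /tangent_at /vf_bracket /=.
rewrite (_ : dt_vf snd = fun=> 1); last by apply/funext => q; exact: derive1_id.
rewrite (_ : Zh snd = fun q => g q.1); last by apply/funext => q; exact: Zh_snd.
rewrite (vector_field_cst _ _ vZh) sub0r /dt_vf /=.
by rewrite (derive1_cst (g p.1)) oppr0.
Qed.

(** Replacing a lifted [Y_i] by its bracket gives the matching term for [Z] on [M]; replacing [d/dt]
    gives 0 by [dt_form_bracket_dt]. *)
Lemma form_lie_cyl k (mu : forms M) Ys (p : M * R) : kform k mu ->
  List.Forall (@vector_field R M) Ys ->
  @form_lie R (cylinder M) Zh (wedge_dt mu) (rcons (map lift_vf Ys) dt_vf) p =
  form_lie Z mu Ys p.1.
Proof.
move=> kmu vYs; have [_ _ _ smu] := kmu.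
rewrite /form_lie; congr (_ - _).
  rewrite -(Zh_fst (Cinf (smu _ vYs))); congr (Zh _ _); apply/funext => q.
  exact: form_eval_cyl.
set L := map lift_vf Ys.
rewrite -(big_mkord xpredT (fun i => form_eval (wedge_dt mu)
  (take i (rcons L dt_vf) ++ @vf_bracket R (cylinder M) Zh (nth (fun=> fun=> 0) (rcons L dt_vf) i)
   :: drop i.+1 (rcons L dt_vf)) p)).
rewrite size_rcons size_map big_nat_recr //= big_mkord.
have sL : size Ys = size L by rewrite size_map.
(* The last summand is the one in which [d/dt] is bracketed. *)
rewrite [X in _ + X](_ : _ = 0) ?addr0; last first.
  rewrite sL -{1}cats1 take_size_cat // nth_rcons ltnn eqxx drop_oversize ?size_rcons // cats1.
  rewrite /form_eval wedge_dtE map_rcons wedge_rcons ?dt_form_bracket_dt ?mulr0 //.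
    exact: dt_form_covector.
  exact: dt_form_lift.
apply: eq_bigr => i _; have iYs := ltn_ord i; have iL : (i < size L)%N by rewrite size_map.
rewrite -{1}cats1 takel_cat ?(ltnW iL) // nth_rcons iL drop_rcons // (nth_map (fun=> fun=> 0)) //.
rewrite /L -map_take -map_drop.
have := vYs; rewrite -{1}(cat_take_drop i Ys) (drop_nth (fun=> fun=> 0) iYs).
move=> /List.Forall_app[v1 /List.Forall_cons_iff[vi v2]].
rewrite /form_eval wedge_dtE -rcons_cons -rcons_cat map_rcons !map_cat !map_cons.
(* The bracket of [Zh] with the lift of [Y_i] also has the [d/dt] component
   [- Y_i g]; it only meets values of [mu] with [d/dt] as an argument. *)
rewrite wedge_rcons_mid.
- by rewrite map_cat map_cons !map_res_lift res_bracket_lift // dt_form_dt mulr1.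
- exact: dt_form_covector.
- exact: dt_form_lift.
- exact: dt_form_lift.
(* [d/dt] projects to the zero functional on [M], and [mu] vanishes as soon as one argument is
   zero. *)
rewrite map_cat map_rcons res_dt !map_res_lift -cats1 catA.
apply: (kform0 kmu); last by constructor.
by apply/List.Forall_app; split; [move: v1|move: v2]; apply: Forall_map => Y;
  exact: vector_field_tangent.
Qed.

End CylinderForms.

(** * Comparison of the two modular forms *)

Section Modular.
Variables (R : realType) (M : manifold R) (n : nat) (A : vbundle M n).
Variables (LA : lie_algebroid A) (phi0 : sections (dual A)) (P : mvec A).
Hypothesis mP : multivector 2 P.
Variables (LAd : lie_algebroid (dual A)) (SAd : schouten LAd).
Hypothesis HAd : induced_dual LA phi0 P LAd.
Variables (LAh : lie_algebroid (pull A)) (LAhd : lie_algebroid (dual (pull A))).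
Variable SAhd : schouten LAhd.
Hypothesis HAh : induced_hat LA phi0 LAh.
Hypothesis HAhd : induced_dual LAh (fun=> 0) (fun p s => expR (- p.2) * @P p.1 s) LAhd.

(** The coordinate [t] is not of the form [e^{ct} h], so the anchor is computed from [induced_hat]
    directly. *)
Lemma lanc_dual_hat_snd (a : sections (dual A)) p : smooth_section a ->
  lanc LAhd (exp_section a) snd p = pairing phi0 (sharp P a) p.1.
Proof.
case: p => x t sa; have [_ Hhd] := HAhd; have [_ Hh] := HAh.
have sPa := sharp_smooth mP sa.
rewrite (Hhd _ (cinf_snd M)) ?sharp_hat //=; last exact: exp_section_smooth.
rewrite (Hh _ (cinf_snd M)) //= vector_field_cst; last exact: lanc_vector_field.
by rewrite add0r derive1_id mulr1.
Qed.

(** Both defining equations are evaluated at [e^t a] upstairs and [a] downstairs, on arguments where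
    [nu] and [mu] are non-zero, and the common factor is cancelled. Keeping [c] free serves both
    claims. *)
Lemma modular_form_hat p (nu : mvec (dual A)) (mu : forms M) c xi xih
    (a : sections (dual A)) x t :
  multivector p nu -> nonvanishing nu -> volume_form mu -> smooth_section a ->
  modular_form SAd nu mu xi ->
  modular_form SAhd (fun q s => expR (c * q.2) * nu q.1 s) (wedge_dt mu) xih ->
  expR t * pairing (xih : sections (dual (dual (pull A))))
    (pull_section a : sections (dual (pull A))) (x, t) =
  pairing xi a x + (c - p%:R) * pairing phi0 (sharp P a) x.
Proof.
move=> mnu nu0 [kmu mu0] sa [_ Hxi] [_ Hxih].
have [s s0] := nu0 x; have [Ys vYs Ys0] := mu0 x.
have sea := exp_section_smooth sa.
have vYh : List.Forall (@vector_field R (cylinder M)) (rcons (map (@lift_vf R M) Ys) (@dt_vf R M)).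
  rewrite -cats1; apply/List.Forall_app; split.
    by move: vYs; apply: Forall_map => Y; exact: lift_vector_field.
  by constructor => //; exact: dt_vector_field.
(* This is [lanc_dual_hat] with [c = 0]. *)
have Zh_fst (h : cinf M) (q : M * R) :
    lanc LAhd (exp_section a) (fun q => h q.1) q = lanc LAd a h q.1.
  case: q => y r; have := lanc_dual_hat HAh mP HAd HAhd 0 h y r sa.
  rewrite !mul0r expR0 mul1r addr0 => <-; congr (lanc _ _ _ _).
  by apply/funext => q; rewrite mul0r expR0 mul1r.
have := Hxih _ sea (x, t) s _ vYh; rewrite form_eval_cyl //.
have vZh : vector_field (lanc LAhd (exp_section a)) by exact: lanc_vector_field.
have Zh_snd (q : M * R) := lanc_dual_hat_snd q sa.
rewrite (form_lie_cyl vZh Zh_fst Zh_snd _ kmu vYs) /=.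
rewrite (@sbr_exp _ _ _ _ _ SAd _ SAhd (fun a => pairing phi0 (sharp P a))
  (lanc_dual_hat HAh mP HAd HAhd) (lbr_dual_hat HAh mP HAd HAhd)
  _ _ _ c x t s sa mnu).
have := Hxi _ sa x s _ vYs.
set w := form_eval mu Ys x; set fl := form_lie _ _ _ _; set B := sbr _ _ _ _.
have -> : pairing xih (exp_section a) (x, t) =
    expR t * pairing (xih : sections (dual (dual (pull A))))
      (pull_section a : sections (dual (pull A))) (x, t).
  exact: linearZ.
move: s0 Ys0; rewrite -/w; set N := nu x s; set X := pairing xi a x; set Xh := _ * pairing _ _ _.
set G := pairing _ _ _; set e := expR _ => /eqP N0 /eqP w0 E1 E2.
have e0 : e != 0 by rewrite gt_eqF // expR_gt0.
have eNw : e * N * w != 0 by rewrite !mulf_neq0.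
apply: (mulIf eNw); move: E1 E2; rewrite -/X -/N.
have -> : (X + (c - p%:R) * G) * (e * N * w) =
  e * (X * (N * w)) + e * ((c - p%:R) * G * N * w) by ring.
by move=> -> ->; ring.
Qed.

End Modular.

(** * The two claims, for [c = n] and [c = 0] *)

Theorem proposition16 (R : realType) (M : manifold R) (n : nat) (A : vbundle M n)
  (LA : lie_algebroid A) (phi0 : sections (dual A))
  (HA : jacobi_algebroid LA phi0)
  (SA : schouten LA) (P : mvec A) (HP : jacobi_bivector SA phi0 P)
  (* A^* with the structure induced by P, and its Schouten bracket *)
  (LAd : lie_algebroid (dual A)) (HAd : induced_dual LA phi0 P LAd)
  (SAd : schouten LAd)
  (* the Lie algebroid A x R induced by phi0 *)
  (LAh : lie_algebroid (pull A)) (HAh : induced_hat LA phi0 LAh)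
  (* its dual with the structure induced by e^{-t} P, and its Schouten bracket *)
  (LAhd : lie_algebroid (dual (pull A)))
  (HAhd : induced_dual LAh (fun=> 0) (fun p s => expR (- p.2) * P p.1 s) LAhd)
  (SAhd : schouten LAhd)
  (nu : mvec (dual A)) (Hnu : multivector n nu) (Hnu0 : nonvanishing nu)
  (mu : forms M) (Hmu : volume_form mu) :
  let X0 : sections A := fun x => - sharp P phi0 x in
  let nuh : mvec (dual (pull A)) := fun p s => expR (n%:R * p.2) * nu p.1 s in
  let nut : mvec (dual (pull A)) := fun p s => nu p.1 s in
  (forall (xi : sections (dual (dual A))) (xih : sections (dual (dual (pull A)))),
     modular_form SAd nu mu xi ->
     modular_form SAhd nuh (wedge_dt mu) xih ->
     forall alpha : sections (dual A), smooth_section alpha ->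
     forall (x : M) (t : R),
       pairing xi alpha x =
       expR t * pairing (xih : sections (dual (dual (pull A))))
                  (pull_section alpha : sections (dual (pull A))) (x, t)) /\
  (forall (xiX : sections (dual (dual A))) (xih : sections (dual (dual (pull A)))),
     jacobi_modular_form SAd (fun x => ev (X0 x)) nu mu xiX ->
     modular_form SAhd nut (wedge_dt mu) xih ->
     forall (x : M) (t : R),
       xiX x = expR t *: (xih (x, t) : fib (dual (dual A)) x) + ev (X0 x)).
Proof.
have mP := HP.1 => X0 nuh nut.
(* The minus sign of [X0] is absorbed by skew-symmetry: [- P(phi0, alpha) = P(alpha, phi0)]. *)
have X0E (alpha : sections (dual A)) x :
    (alpha x : 'Hom(fib A x, R^o)) (X0 x) = pairing phi0 (sharp P alpha) x.
  rewrite /X0 linearN /pairing /= (@sharpE _ _ _ A P phi0 x (alpha x) mP).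
  by rewrite (@sharpE _ _ _ A P alpha x (phi0 x) mP) [in RHS](@bivectorC _ _ _ A P x _ _ mP).
split=> [xi xih Hxi Hxih alpha sa x t|xiX xih [xi0 Hxi0 xiXE] Hxih x t].
  by rewrite (modular_form_hat mP HAd HAh HAhd x t Hnu Hnu0 Hmu sa Hxi Hxih) subrr mul0r addr0.
(* The unscaled [nu] is the case [c = 0]. *)
have nutE : nut = fun q s => expR (0 * q.2) * nu q.1 s.
  by apply: mvec_ext => q s; rewrite mul0r expR0 mul1r.
rewrite nutE in Hxih.
apply/lfunP => a; have [alpha sa <-] := @section_through _ _ _ (dual A) x a.
have := modular_form_hat mP HAd HAh HAhd x t Hnu Hnu0 Hmu sa Hxi0 Hxih.
(* With [g = alpha(X0)], [H] says that [e^t xih(alpha)] is [xi0(alpha) - n g]; subtracting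
   [(n - 1) g] instead of [n g] leaves the extra summand [X0]. *)
rewrite -X0E xiXE add_lfunE opp_lfunE !scale_lfunE !evE /pairing /GRing.scale /= => H.
rewrite add_lfunE scale_lfunE evE /GRing.scale /= H; ring.
Qed.
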